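(* Let $\{P_i : i\in I\}$ be a family of symmetric strips $$P_i=\{x\in\mathbb{R}^n : |\langle x,w_i\rangle|\leq 1\},\qquad w_i\in\mathbb{R}^n,$$ in $\mathbb{R}^n$ such that $P=\bigcap_{i\in I}P_i$ has positive volume. For every real $d>1$ there exist $s\leq dn$ and $i_1,\ldots,i_s\in I$ such that $$|P_{i_1}\cap\cdots\cap P_{i_s}|\leq\left(\frac{4\gamma_d}{\pi}\right)^{\frac{n}{2}}\Gamma\left(\frac{n}{2}+1\right)|P|,$$ where $\gamma_d:=\left(\frac{\sqrt{d}+1}{\sqrt{d}-1}\right)^2$.
   Context: $|\cdot|$ denotes $n$-dimensional volume (Lebesgue measure) in $\mathbb{R}^n$, with values in $[0,+\infty]$; $\langle\cdot,\cdot\rangle$ is the Euclidean inner product; $\Gamma$ is the Gamma function; $s$ is an integer. The family may be infinite. *)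

(* Defs.v *)
From HB Require Import structures.
From mathcomp Require Import all_boot all_order all_algebra.
From mathcomp Require Import all_classical all_reals all_analysis.

Set Implicit Arguments.
Unset Strict Implicit.
Unset Printing Implicit Defensive.

Import Order.TTheory GRing.Theory Num.Theory.
Import numFieldNormedType.Exports.

Local Open Scope classical_set_scope.
Local Open Scope ring_scope.

Section tuple_measure.
Context {R : realType}.
Local Notation RT := (measurableTypeR R).

Definition tuple_cons (n : nat) (xt : RT * n.-tuple RT) : n.+1.-tuple RT :=
  [tuple of xt.1 :: xt.2].

Lemma measurable_tuple_cons (n : nat) : measurable_fun setT (@tuple_cons n).
Proof. exact: measurable_cons. Qed.

Section step.
Variables (n : nat) (m : {sigma_finite_measure set (n.-tuple RT) -> \bar R}).

Local Notation prod_measure :=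
  ((lebesgue_measure : {sigma_finite_measure set RT -> \bar R}) \x m)%E.

Definition cons_measure : set (n.+1.-tuple RT) -> \bar R :=
  pushforward prod_measure (@tuple_cons n).

Let mtc := @measurable_tuple_cons n.

Let cons_measure0 : cons_measure set0 = 0%E.
Proof. exact: measure0. Qed.

Let cons_measure_ge0 A : (0 <= cons_measure A)%E.
Proof. exact: measure_ge0. Qed.

Let cons_measure_sigma_additive : semi_sigma_additive cons_measure.
Proof.
move=> F mF tF mUF.
exact: (@measure_semi_sigma_additive _ _ _ (pushforward prod_measure (@tuple_cons n))).
Qed.

HB.instance Definition _ := isMeasure.Build _ _ _ cons_measure
  cons_measure0 cons_measure_ge0 cons_measure_sigma_additive.

Lemma cons_measureX (A : set RT) (B : set (n.-tuple RT)) :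
  measurable A -> measurable B ->
  cons_measure [set t | A (thead t) /\ B [tuple of behead t]] =
  (lebesgue_measure A * m B)%E.
Proof.
move=> mA mB.
have <- : prod_measure (A `*` B) = (lebesgue_measure A * m B)%E.
  exact: product_measure1E.
rewrite /cons_measure /pushforward; congr (product_measure1 _ _ _).
apply/seteqP; split => -[x t] /=.
- by rewrite theadE (_ : [tuple of _] = t)//; exact/val_inj.
- by rewrite theadE (_ : [tuple of _] = t)//; exact/val_inj.
Qed.

Let cons_measure_sigma_finite : sigma_finite setT cons_measure.
Proof.
have /sigma_finiteP[F [TF ndF Foo]] := sigma_finiteT (@lebesgue_measure R).
have /sigma_finiteP[G [TG ndG Goo]] := sigma_finiteT m.
exists (fun k => [set t | F k (thead t) /\ G k [tuple of behead t]]).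
  apply/seteqP; split => // t _.
  have [i _ Fi] : (\bigcup_i F i) (thead t) by rewrite -TF.
  have [j _ Gj] : (\bigcup_i G i) [tuple of behead t] by rewrite -TG.
  exists (maxn i j) => //; split.
    by move: Fi; exact/subsetPset/ndF/leq_maxl.
  by move: Gj; exact/subsetPset/ndG/leq_maxr.
move=> k; have [mF Fk] := Foo k; have [mG Gk] := Goo k; split.
  apply: measurableI.
    by rewrite -[X in measurable X]setTI; exact: measurable_tnth.
  by rewrite -[X in measurable X]setTI; exact: measurable_behead.
by rewrite cons_measureX// lte_mul_pinfty// ge0_fin_numE.
Qed.

HB.instance Definition _ := Measure_isSigmaFinite.Build _ _ _ cons_measure
  cons_measure_sigma_finite.

End step.

(* n-dimensional Lebesgue measure on the Borel sets of R^n (the library has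
   product measures of two measures only): iterated product of the Lebesgue
   measure of R, the 0-dimensional measure giving mass 1 to the one point. *)
Fixpoint lebesgue_tuple (n : nat) :
    {sigma_finite_measure set (n.-tuple RT) -> \bar R} :=
  match n with
  | 0 => \d_([tuple] : 0.-tuple RT)
  | k.+1 => cons_measure (lebesgue_tuple k)
  end.


Let tnth_beheadE (n : nat) (t : n.+1.-tuple RT) (i : 'I_n) :
  tnth [tuple of behead t] i = tnth t (lift ord0 i).
Proof.
rewrite tnth_behead; congr (tnth t _); apply/val_inj.
by rewrite /= inordK// ltnS.
Qed.

Lemma lebesgue_tuple_box (n : nat) (A : 'I_n -> set RT) :
  (forall i, measurable (A i)) ->
  lebesgue_tuple n [set t | forall i, A i (tnth t i)] =
  (\prod_(i < n) lebesgue_measure (A i))%E.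
Proof.
elim: n => [|n IH] in A *.
  move=> _; rewrite big_ord0 /= diracE mem_set//= => -[].
  by [].
move=> mA; rewrite big_ord_recl -IH; last by move=> i; exact: mA.
rewrite -cons_measureX//; last first.
  rewrite [X in measurable X](_ : _ = \bigcap_(i in [set: 'I_n])
    ((fun t : n.-tuple RT => tnth t i) @^-1` A (lift ord0 i))).
    apply: fin_bigcap_measurable => // i _.
    by rewrite -[X in measurable X]setTI; exact: measurable_tnth.
  by apply/seteqP; split => t /= + i; [move=> /(_ i)|move=> /(_ i I)].
congr (cons_measure _ _); apply/seteqP; split => t /=.
  move=> At; split; first exact: At.
  by move=> i; have := At (lift ord0 i); rewrite tnth_beheadE.
move=> [A0 AS] i; case: (unliftP ord0 i) => [j ->|->//].
by have := AS j; rewrite tnth_beheadE.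
Qed.

End tuple_measure.

Section strips.
Context {R : realType}.

(* Lebesgue measure on the row vectors 'rV[R]_n, with values in [0, +oo]. As
   for any library measure, it is only meaningful on measurable sets, here
   Borel sets; this covers all closed sets, hence intersections of strips. *)
Definition volume (n : nat) (A : set 'rV[R]_n) : \bar R :=
  lebesgue_tuple n [set t | A (\row_i tnth t i)].

Lemma volume_box (n : nat) (A : 'I_n -> set (measurableTypeR R)) :
  (forall i, measurable (A i)) ->
  volume [set x : 'rV[R]_n | forall i, A i (x ord0 i)] =
  (\prod_(i < n) lebesgue_measure (A i))%E.
Proof.
move=> mA; rewrite -lebesgue_tuple_box// /volume.
by congr (lebesgue_tuple _ _); apply/seteqP; split => t /= + i => /(_ i);
  rewrite mxE.
Qed.

Definition inner (n : nat) (x w : 'rV[R]_n) : R :=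
  \sum_(i < n) x ord0 i * w ord0 i.

Definition strip (n : nat) (w : 'rV[R]_n) : set 'rV[R]_n :=
  [set x | `|inner x w| <= 1].

(* Euler's integral, used only at arguments > 0, where it is finite. *)
Definition Gamma (x : R) : R :=
  \int[lebesgue_measure]_(t in `]0, +oo[) (t `^ (x - 1) * expR (- t)).

Definition gamma_ratio (d : R) : R :=
  ((Num.sqrt d + 1) / (Num.sqrt d - 1)) ^+ 2.

End strips.

(* Main.v *)
Require Import Defs.
From HB Require Import structures.
From mathcomp Require Import fingroup perm.
From mathcomp Require Import all_boot all_order all_algebra.
From mathcomp Require Import all_classical all_reals all_analysis.
From mathcomp Require Import measurable_realfun ring lra.

Set Implicit Arguments.
Unset Strict Implicit.
Unset Printing Implicit Defensive.

Import Order.TTheory GRing.Theory Num.Theory.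
Import numFieldNormedType.Exports.

Local Open Scope classical_set_scope.
Local Open Scope ring_scope.

(** Let s be the integer part of dn, and choose strips i_1, ..., i_s whose normals
    u_1, ..., u_s almost maximize det M, where M = sum_j u_j^T u_j.
    Exchanging one u_j for an arbitrary normal w of the family cannot increase
    det M by much; averaging over j, this says that P contains the ellipsoid
    x M x^T <= (s - n + 1) / n, up to an arbitrarily small error.  Its volume is
    computed from the Gaussian integral of exp (- x M x^T).  In the other
    direction, Ball's form of the rank one Brascamp-Lieb inequality bounds the
    volume of the intersection of the s strips by 2^n (s/n)^(n/2) det M^(-1/2).
    The quotient of the two volumes involves s / (s - n + 1) in place of
    gamma_d, and s / (s - n + 1) < gamma_d because s + 1 > dn; the strict
    inequality absorbs all the approximations.

    Ball's inequality is proved by transporting the intersection of the strips to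
    a Gaussian as in Barthe's proof of the Brascamp-Lieb inequality, with a
    piecewise affine transport, so that only affine changes of variables
    are needed. *)

(** * One-dimensional affine substitution *)

Lemma ge0_integral_affine (R : realType) (f : measurableTypeR R -> \bar R) (a b : R) :
  0 < a -> measurable_fun [set: measurableTypeR R] f -> (forall x, (0 <= f x)%E) ->
  (\int[lebesgue_measure]_x f (a * x + b)%R =
   (a^-1)%:E * \int[lebesgue_measure]_x f x)%E.
Proof.
move=> a0 mf f0.
have a1 : 0 <= a^-1 by rewrite invr_ge0 ltW.
pose phi (x : measurableTypeR R) : measurableTypeR R := a * x + b.
have mphi : measurable_fun setT phi.
  by apply: measurable_funD => //; apply: measurable_funM.
transitivity (\int[mscale (NngNum a1) lebesgue_measure]_x f x)%E; last first.
  by rewrite ge0_integral_mscale.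
transitivity (\int[pushforward lebesgue_measure phi]_x f x)%E.
  by rewrite ge0_integral_pushforward.
apply: eq_measure_integral => A mA _.
pose m0 : {measure set (measurableTypeR R) -> \bar R} := pushforward lebesgue_measure phi.
pose m1 : {measure set (measurableTypeR R) -> \bar R} := mscale (NngNum (ltW a0)) (m0 mphi).
(* Lebesgue measure is determined by its values on half-open intervals, so [a] times the
   push-forward is compared with it there. *)
have E : lebesgue_measure A = m1 A.
  apply: lebesgue_measure_unique => // _ [[u v] _ <-].
  rewrite /m1 /m0 /mscale/= /pushforward.
  rewrite [X in _ = (_ * lebesgue_measure X)%E](_ : _ = `](u - b) / a, (v - b) / a]%classic);
    last first.
    apply/seteqP; split => x /=; rewrite !in_itv/= /phi;
      by rewrite ltr_pdivrMr// ler_pdivlMr// (mulrC x a) ltrBlDr lerBrDr.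
  rewrite /mscale/= !lebesgue_measure_itv/= !lte_fin ltr_pM2r ?invr_gt0// ltrD2r.
  case: ifP => _; last by rewrite mule0.
  rewrite -!EFinD -EFinM; congr (_%:E); field; exact: lt0r_neq0.
transitivity ((a^-1)%:E * lebesgue_measure A)%E; last by [].
rewrite E /m1/= /mscale/= muleA -EFinM mulVf ?mul1e//.
exact: lt0r_neq0.
Qed.

(** * Integration over row vectors *)

Section vint.
Context {R : realType}.
Local Notation RT := (measurableTypeR R).

(** The sigma-algebra and [lebesgue_tuple] live on tuples, linear algebra on row vectors; [vec] and
    [unvec] pass between the two. *)
Definition vec n (t : n.-tuple RT) : 'rV[R]_n := \row_i tnth t i.
Definition unvec n (x : 'rV[R]_n) : n.-tuple RT := [tuple x ord0 i | i < n].

Lemma unvecK n : cancel (@unvec n) (@vec n).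
Proof. by move=> t; apply/rowP => i; rewrite mxE tnth_mktuple. Qed.

Definition vmeas n (f : 'rV[R]_n -> \bar R) := measurable_fun setT (f \o @vec n).

Definition vint n (f : 'rV[R]_n -> \bar R) : \bar R :=
  (\int[lebesgue_tuple n]_t f (vec t))%E.

Lemma vmeas_comp d (T : measurableType d) n (f : 'rV[R]_n -> \bar R)
    (g : T -> 'rV[R]_n) :
  vmeas f -> (forall i, measurable_fun setT (fun x => g x ord0 i : RT)) ->
  measurable_fun setT (fun x => f (g x)).
Proof.
move=> mf mg.
rewrite (_ : (fun x => _) = (f \o @vec n) \o (@unvec n \o g)); last first.
  by apply/funext => x /=; rewrite unvecK.
apply: measurableT_comp => //; apply/measurable_fun_tnthP => i.
rewrite (_ : _ \o _ = fun x => g x ord0 i)//.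
by apply/funext => x /=; rewrite tnth_mktuple.
Qed.

Lemma measurable_vec n i : measurable_fun setT (fun t => @vec n t ord0 i : RT).
Proof.
rewrite (_ : (fun t => _) = fun t => tnth t i); first exact: measurable_tnth.
by apply/funext => t; rewrite mxE.
Qed.

Lemma measurable_coord_affine d (T : measurableType d) m n (g : T -> 'rV[R]_m)
    (A : 'M[R]_(m, n)) (c : 'rV[R]_n) :
  (forall i, measurable_fun setT (fun x => g x ord0 i : RT)) ->
  forall i, measurable_fun setT (fun x => (g x *m A + c) ord0 i : RT).
Proof.
move=> mg i.
rewrite (_ : (fun x => _) = fun x => \sum_k g x ord0 k * A k i + c ord0 i).
  apply: measurable_funD => //; apply: measurable_sum => k.
  apply: (@measurable_funM _ _ _ _ (fun x => g x ord0 k) (fun=> A k i)) => //.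
  exact: mg.
by apply/funext => x; rewrite !mxE.
Qed.

Lemma measurable_coord_row d (T : measurableType d) n (h : T -> RT)
    (g : T -> 'rV[R]_n) :
  measurable_fun setT h ->
  (forall i, measurable_fun setT (fun x => g x ord0 i : RT)) ->
  forall i, measurable_fun setT
    (fun x => (row_mx (h x)%:M (g x) : 'rV_(1 + n)) ord0 i : RT).
Proof.
move=> mh mg i; case: (fintype.split_ordP i) => j ->.
- rewrite (_ : (fun x => _) = h)//; apply/funext => x.
  by rewrite row_mxEl mxE !ord1 eqxx mulr1n.
- rewrite (_ : (fun x => _) = fun x => g x ord0 j)//; apply/funext => x.
  by rewrite row_mxEr.
Qed.

Lemma vec_cons n (x : RT) (t : n.-tuple RT) :
  vec (tuple_cons (x, t)) = row_mx x%:M (vec t) :> 'rV_(1 + n).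
Proof.
apply/rowP => i; rewrite mxE; case: (fintype.split_ordP i) => j ->.
- rewrite [RHS](row_mxEl (x%:M : 'M[R]_1) (vec t)) mxE !ord1 eqxx mulr1n.
  by rewrite -[RHS](tnth0 x t); congr (tnth _ _); apply/val_inj.
- rewrite [RHS](row_mxEr (x%:M : 'M[R]_1) (vec t)) mxE -[RHS](tnthS x t).
  by congr (tnth _ _); apply/val_inj.
Qed.

Section cons.
Variables (n : nat) (f : 'rV[R]_(1 + n) -> \bar R).
Hypotheses (mf : vmeas f) (f0 : forall x, (0 <= f x)%E).

Lemma measurable_vcons :
  measurable_fun setT (fun z : RT * n.-tuple RT => f (row_mx z.1%:M (vec z.2))).
Proof.
apply: vmeas_comp => //; apply: measurable_coord_row => // i.
exact: (measurableT_comp (measurable_vec i) measurable_snd).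
Qed.

Lemma vint_fubini1 :
  vint f = (\int[lebesgue_measure]_x vint (fun v => f (row_mx x%:M v)))%E.
Proof.
rewrite /vint /= ge0_integral_pushforward//=; last exact: measurable_tuple_cons.
rewrite preimage_setT.
rewrite (eq_integral (fun z : RT * n.-tuple RT => f (row_mx z.1%:M (vec z.2)))).
  by rewrite fubini_tonelli1//; exact: measurable_vcons.
by move=> [x t] _ /=; rewrite vec_cons.
Qed.

Lemma vint_fubini2 :
  vint f = vint (fun v => \int[lebesgue_measure]_x f (row_mx x%:M v))%E.
Proof.
rewrite vint_fubini1 /vint.
exact: (fubini_tonelli (m1 := lebesgue_measure) (m2 := lebesgue_tuple n)
  (fun z : RT * n.-tuple RT => f (row_mx z.1%:M (vec z.2))) measurable_vcons).
Qed.

Lemma measurable_vint1 :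
  measurable_fun setT (fun x : RT => vint (fun v => f (row_mx x%:M v))).
Proof.
exact: (measurable_fun_fubini_tonelli_F (m2 := lebesgue_tuple n) _ measurable_vcons).
Qed.

End cons.

Lemma vint_ge0 n (f : 'rV[R]_n -> \bar R) : (forall x, 0 <= f x)%E -> (0 <= vint f)%E.
Proof. by move=> f0; apply: integral_ge0. Qed.

Lemma eq_vint n (f g : 'rV[R]_n -> \bar R) : f =1 g -> vint f = vint g.
Proof. by move=> fg; apply: eq_integral => t _; rewrite fg. Qed.

Lemma vintZl n (f : 'rV[R]_n -> \bar R) (k : R) :
  vmeas f -> (forall x, 0 <= f x)%E -> 0 <= k ->
  vint (fun x => k%:E * f x)%E = (k%:E * vint f)%E.
Proof. by move=> mf f0 k0; rewrite /vint ge0_integralZl. Qed.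

Lemma le_vint n (f g : 'rV[R]_n -> \bar R) :
  vmeas f -> vmeas g -> (forall x, 0 <= f x)%E -> (forall x, f x <= g x)%E ->
  (vint f <= vint g)%E.
Proof.
move=> mf mg f0 fg; apply: ge0_le_integral => // t _; exact: (le_trans (f0 _)).
Qed.

End vint.

(** * Positive definite forms and Schur complements *)

Section posdef.
Context {R : realType}.

Definition qform n (B : 'M[R]_n) (x : 'rV[R]_n) : R := (x *m B *m x^T) ord0 ord0.

Definition posdef n (B : 'M[R]_n) :=
  B^T = B /\ forall x, x != 0 -> 0 < qform B x.

Lemma posdef_qform_ge0 n (B : 'M[R]_n) x : posdef B -> 0 <= qform B x.
Proof.
move=> [_ pB]; have [->|/pB/ltW//] := eqVneq x 0.
by rewrite /qform !mul0mx mxE.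
Qed.

(** Completing the square in the first coordinate: [a] is the corner entry, [S] its Schur
    complement, [y] the shifted coordinate. The formula for the product by [B] serves the change of
    variables, the one for the form serves the Gaussian integral. *)
Lemma posdef_schur n (B : 'M[R]_(1 + n)) : posdef B ->
  exists a (b : 'rV[R]_n) (S : 'M[R]_n),
    [/\ 0 < a, posdef S, \det B = a * \det S &
    forall (x : R) (v : 'rV[R]_n), let y := x + a^-1 * (v *m b^T) ord0 ord0 in
      row_mx x%:M v *m B = row_mx (a * y)%:M (y *: b + v *m S) /\
      qform B (row_mx x%:M v) = a * y ^+ 2 + qform S v].
Proof.
move=> [Bs Bp].
pose a := B (lshift n ord0) (lshift n ord0).
pose b : 'rV[R]_n := ursubmx B.
pose D : 'M[R]_n := drsubmx B.
have BE : B = block_mx a%:M b b^T D.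
  rewrite -[LHS]submxK; congr block_mx.
  - by apply/matrixP => i j; rewrite !ord1 !mxE eqxx mulr1n.
  - by rewrite -{1}Bs -trmx_ursub.
have scal (u : 'M[R]_1) : u = (u ord0 ord0)%:M.
  by apply/matrixP => i j; rewrite !ord1 mxE eqxx mulr1n.
have a0 : 0 < a.
  have /Bp : (row_mx 1%:M 0 : 'rV[R]_(1 + n)) != 0.
    apply/eqP => /rowP/(_ (lshift n ord0)); rewrite row_mxEl !mxE/= => /eqP.
    by rewrite oner_eq0.
  rewrite /qform BE mul_row_block !mul0mx !addr0 !mul1mx tr_row_mx mul_row_col.
  by rewrite trmx0 mulmx0 addr0 trmx1 mulmx1 mxE eqxx mulr1n.
have aN0 : a != 0 by rewrite gt_eqF.
pose S := D - a^-1 *: (b^T *m b).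
have mulB (x : R) (v : 'rV[R]_n) : let y := x + a^-1 * (v *m b^T) ord0 ord0 in
    row_mx x%:M v *m B = row_mx (a * y)%:M (y *: b + v *m S).
  move=> y; rewrite BE mul_row_block; congr row_mx.
    rewrite [v *m b^T]scal -scalar_mxM -raddfD/=; congr (_%:M).
    by rewrite /y mulrDr mulrA divff// mul1r mulrC.
  rewrite mul_scalar_mx /S mulmxBr -scalemxAr mulmxA.
  rewrite [X in _ *: (X *m b)]scal.
  by rewrite mul_scalar_mx scalerA /y scalerDl addrACA subrr addr0 addrC.
have qB (x : R) (v : 'rV[R]_n) : let y := x + a^-1 * (v *m b^T) ord0 ord0 in
    qform B (row_mx x%:M v) = a * y ^+ 2 + qform S v.
  move=> y; rewrite /qform mulB -/y tr_row_mx mul_row_col tr_scalar_mx mulmxDl.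
  rewrite -scalemxAl -[b *m v^T]trmxK trmx_mul trmxK [v *m b^T]scal.
  rewrite tr_scalar_mx -scalar_mxM !mxE eqxx !mulr1n addrA; congr (_ + _).
  have <- : a * (y - x) = \sum_j v ord0 j * b^T j ord0.
    by rewrite /y addrC addKr mulrA divff// mul1r mxE.
  ring.
exists a, b, S; split => //.
- split.
    rewrite /S linearB/= linearZ/= trmx_mul trmxK; congr (_ - _).
    by rewrite /D trmx_drsub Bs.
  (* This [x] makes the shifted coordinate vanish, so [qform B] reduces to [qform S v]. *)
  move=> v v0; pose x := - (a^-1 * (v *m b^T) ord0 ord0).
  have /Bp : (row_mx x%:M v : 'rV[R]_(1 + n)) != 0.
    apply: contra v0 => /eqP E; apply/eqP.
    by rewrite -[v](row_mxKr x%:M) E linear0.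
  by rewrite qB /x addNr expr0n/= mulr0 add0r.
- have -> : B = block_mx 1%:M 0 (a^-1 *: b^T) 1%:M *m block_mx a%:M b 0 S.
    rewrite BE mulmx_block !mul0mx !mul1mx !addr0; congr block_mx.
    + by rewrite mul_mx_scalar scalerA divff// scale1r.
    + by rewrite /S -scalemxAl addrC subrK.
  by rewrite det_mulmx det_lblock det_ublock !det1 !mul1r det_scalar1.
Qed.

Lemma det_posdef n (B : 'M[R]_n) : posdef B -> 0 < \det B.
Proof.
elim: n => [|n IH] in B *; first by rewrite det_mx00.
by move=> /posdef_schur[a [b [S [a0 /IH S0 -> _]]]]; rewrite mulr_gt0.
Qed.

Lemma row_mx_surj n (x : 'rV[R]_(1 + n)) :
  x = row_mx (x ord0 (lshift n ord0))%:M (rsubmx x).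
Proof.
rewrite -[LHS]hsubmxK; congr row_mx.
by apply/matrixP => i j; rewrite !ord1 !mxE eqxx mulr1n.
Qed.

End posdef.

(** * Change of variables by a positive definite matrix *)

Section posdef_integral.
Context {R : realType}.
Local Notation RT := (measurableTypeR R).

Lemma vint0 (f : 'rV[R]_0 -> \bar R) :
  vmeas f -> vint f = f 0.
Proof.
move=> mf; rewrite /vint /= integral_dirac//= diracT mul1e.
by congr f; apply/rowP => -[].
Qed.

Lemma vmeas_row n (f : 'rV[R]_(1 + n) -> \bar R) x :
  vmeas f -> vmeas (fun v => f (row_mx x%:M v)).
Proof.
move=> mf; apply: (vmeas_comp (g := fun t => row_mx x%:M (vec t))) => //.
by apply: (measurable_coord_row (h := fun=> x)) => // i; exact: measurable_vec.
Qed.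

Lemma vmeas_affine m n (f : 'rV[R]_n -> \bar R) (A : 'M[R]_(m, n)) c :
  vmeas f -> vmeas (fun x => f (x *m A + c)).
Proof.
move=> mf; apply: (vmeas_comp (g := fun t => vec t *m A + c)) => //.
by apply: measurable_coord_affine => i; exact: measurable_vec.
Qed.

Lemma measurable_row1 n (f : 'rV[R]_(1 + n) -> \bar R) v :
  vmeas f -> measurable_fun [set: RT] (fun x => f (row_mx x%:M v)).
Proof.
move=> mf; apply: (vmeas_comp (g := fun x : RT => row_mx x%:M v)) => //.
by apply: (measurable_coord_row (h := id) (g := fun=> v)) => // i; exact: measurable_cst.
Qed.

(* With the Schur complement, the substitution is a shear in the first coordinate
   followed by the same statement in dimension n - 1. *)
Lemma vint_affine n (B : 'M[R]_n) (c : 'rV[R]_n) (f : 'rV[R]_n -> \bar R) :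
  posdef B -> vmeas f -> (forall x, 0 <= f x)%E ->
  vint (fun x => f (x *m B + c)) = ((\det B)^-1%:E * vint f)%E.
Proof.
elim: n => [|n IH] in B c f *.
  move=> _ _ f0; rewrite det_mx00 invr1 mul1e; apply: eq_vint => x.
  by rewrite [LHS](_ : _ = f x)//; congr f; apply/rowP => -[].
move: B c f; rewrite -[n.+1]/(1 + n)%N => B c f.
move=> /posdef_schur[a [b [S [a0 pS -> BE]]]] mf f0.
pose f' x := f (x *m block_mx a%:M b 0 S + c).
have mf' : vmeas f' by exact: vmeas_affine.
have f'0 x : (0 <= f' x)%E by exact: f0.
transitivity (vint f').
  rewrite [LHS](vint_fubini2 (vmeas_affine B c mf) (fun x => f0 _)).
  rewrite [RHS](vint_fubini2 mf' f'0); apply: eq_vint => v.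
  transitivity (\int[lebesgue_measure]_x f'
      (row_mx (1 * x + a^-1 * (v *m b^T) ord0 ord0)%:M v))%E.
    apply: eq_integral => x _; rewrite mul1r /f' (BE x v).1 mul_row_block.
    by rewrite mulmx0 addr0 -scalar_mxM mul_scalar_mx mulrC.
  rewrite (@ge0_integral_affine _ (fun y => f' (row_mx y%:M v)))//.
    by rewrite invr1 mul1e.
  exact: measurable_row1.
pose c0 := c ord0 (lshift n ord0); pose c' : 'rV[R]_n := rsubmx c.
pose H (z : R) := vint (fun v => f (row_mx z%:M v)).
have mH : measurable_fun [set: RT] H by exact: measurable_vint1.
have H0 z : (0 <= H z)%E by exact: vint_ge0.
transitivity (\int[lebesgue_measure]_y ((\det S)^-1%:E * H (a * y + c0)%R))%E.
  rewrite [LHS](vint_fubini1 mf' f'0); apply: eq_integral => y _.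
  rewrite -(IH S (y *: b + c') (fun v => f (row_mx (a * y + c0)%:M v)))//.
    apply: eq_vint => v; rewrite /f' mul_row_block [c in LHS]row_mx_surj.
    rewrite add_row_mx mulmx0 addr0 -scalar_mxM mul_scalar_mx -raddfD/=.
    by congr (f (row_mx _ _)); rewrite ?(mulrC a)// addrCA addrA.
  exact: vmeas_row.
rewrite ge0_integralZl//; last 2 first.
- have mphi : measurable_fun [set: RT] (fun y : RT => a * y + c0 : RT).
    by apply: measurable_funD => //; apply: measurable_funM.
  exact: (measurableT_comp mH mphi).
- by rewrite lee_fin invr_ge0 ltW// det_posdef.
rewrite (@ge0_integral_affine _ H)//.
by rewrite muleA -EFinM -invfM mulrC vint_fubini1.
Qed.

End posdef_integral.

(** * Gaussian integrals and volumes of ellipsoids *)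

Section ellipsoid.
Context {R : realType}.
Local Notation RT := (measurableTypeR R).
Local Notation mu := (@lebesgue_measure R).

Lemma qformE n (B : 'M[R]_n) x : qform B x = \sum_j (x *m B + 0) ord0 j * x ord0 j.
Proof. by rewrite /qform mxE; apply: eq_bigr => j _; rewrite addr0 [x^T _ _]mxE. Qed.

Lemma qformZ n (B : 'M[R]_n) k x : qform B (k *: x) = k ^+ 2 * qform B x.
Proof.
by rewrite /qform linearZ/= -!scalemxAl -scalemxAr scalerA -expr2 mxE.
Qed.

Lemma measurable_qform n (B : 'M[R]_n) :
  measurable_fun setT (fun t : n.-tuple RT => qform B (vec t)).
Proof.
under eq_fun do rewrite qformE.
apply: measurable_sum => j; apply: (@measurable_funM _ _ _ _
  (fun t => (vec t *m B + 0) ord0 j) (fun t => vec t ord0 j)).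
  by apply: measurable_coord_affine => i; exact: measurable_vec.
exact: measurable_vec.
Qed.

Definition measurable_vset n (A : set 'rV[R]_n) :=
  measurable [set t : n.-tuple RT | A (vec t)].

Lemma vmeas_indic n (A : set 'rV[R]_n) :
  measurable_vset A -> vmeas (fun x => (\1_A x)%:E).
Proof.
move=> mA; apply/measurable_EFinP.
exact: (@measurable_indic _ _ R setT _ mA).
Qed.

Lemma volume_vint n (A : set 'rV[R]_n) :
  measurable_vset A -> volume A = vint (fun x => (\1_A x)%:E).
Proof.
move=> mA; have := integral_indic (lebesgue_tuple n) measurableT mA.
by rewrite setIT => /esym.
Qed.

Lemma le_volume n (A B : set 'rV[R]_n) :
  measurable_vset A -> measurable_vset B -> A `<=` B -> (volume A <= volume B)%E.
Proof.
move=> mA mB AB; apply: le_measure; [exact: mem_set|exact: mem_set|].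
by move=> t; exact: AB.
Qed.

Lemma vmeas_gauss n (B : 'M[R]_n) : vmeas (fun x => (expR (- qform B x))%:E).
Proof.
apply/measurable_EFinP; apply: measurableT_comp => //.
by apply: measurable_funN; exact: measurable_qform.
Qed.

Lemma measurable_scaled_gauss (a c : R) :
  measurable_fun [set: RT] (fun x : RT => (expR (- (a * (x + c) ^+ 2)))%:E).
Proof.
apply/measurable_EFinP; apply: measurableT_comp => //.
apply: measurable_funN; apply: measurable_funM => //.
by apply: measurable_funX; exact: measurable_funD.
Qed.

Lemma integral_gauss_scale (a c : R) : 0 < a ->
  (\int[mu]_x (expR (- (a * (x + c) ^+ 2)))%:E = (Num.sqrt (pi / a))%:E)%E.
Proof.
move=> a0; pose s := Num.sqrt a; have s0 : 0 < s by rewrite sqrtr_gt0.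
transitivity (\int[mu]_x (gauss_fun (s * x + s * c))%:E)%E.
  apply: eq_integral => x _; rewrite /gauss_fun -mulrDr exprMn sqr_sqrtr//.
  exact: ltW.
rewrite (@ge0_integral_affine _ (fun x => (gauss_fun x)%:E))//.
- by rewrite integralT_gauss -EFinM mulrC sqrtrM ?pi_ge0// sqrtrV// ltW.
- by apply/measurable_EFinP; exact: measurable_gauss_fun.
- by move=> x; rewrite lee_fin gauss_fun_ge0.
Qed.

(** Integrating out the first coordinate gives sqrt(pi / a) whatever the other coordinates are, and
    det B = a det S. *)
Lemma vint_gauss n (B : 'M[R]_n) : posdef B ->
  vint (fun x => (expR (- qform B x))%:E) = (Num.sqrt (pi ^+ n / \det B))%:E.
Proof.
elim: n => [|n IH] in B *.
  move=> _; rewrite vint0; last exact: vmeas_gauss.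
  rewrite /qform !mul0mx mxE oppr0 expR0 det_mx00 expr0 divr1.
  by rewrite sqrtr1.
move: B; rewrite -[n.+1]/(1 + n)%N => B.
move=> /posdef_schur[a [b [S [a0 pS -> BE]]]].
rewrite vint_fubini2//; last exact: vmeas_gauss.
transitivity (vint (fun v => (Num.sqrt (pi / a))%:E * (expR (- qform S v))%:E)%E).
  apply: eq_vint => v.
  have m1 : measurable_fun [set: RT] (fun x : RT =>
      (expR (- (a * (x + a^-1 * (v *m b^T) ord0 ord0) ^+ 2)))%:E).
    exact: measurable_scaled_gauss.
  rewrite -(integral_gauss_scale (a^-1 * (v *m b^T) ord0 ord0) a0) muleC.
  rewrite -ge0_integralZl//.
  by apply: eq_integral => x _; rewrite (BE x v).2 opprD expRD mulrC.
rewrite vintZl// ?lee_fin//; last exact: vmeas_gauss.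
rewrite IH// -EFinM -sqrtrM ?divr_ge0 ?pi_ge0 ?ltW//.
by rewrite exprS invfM mulrACA.
Qed.

(** The integrand is a multiple of the exponential density of rate 1 translated by [u], which has
    mass 1. With [u] a value of the form, this writes the Gaussian as an integral over levels
    [t]. *)
Lemma integral_expR_tail (u : R) : 0 <= u ->
  (\int[mu]_t (expR (- t) * \1_[set t | u <= t] t)%:E = (expR (- u))%:E)%E.
Proof.
move=> u0.
transitivity (\int[mu]_t ((expR (- u))%:E * (exponential_pdf 1 (1 * t - u))%:E))%E.
  apply: eq_integral => t _; rewrite mul1r indicE; have [ut|tu] := leP u t.
    rewrite mem_set//= mulr1 exponential_pdfE ?subr_ge0//.
    by rewrite mul1r -EFinM -expRD; congr (expR _)%:E; ring.
  rewrite memNset/= ?mulr0; last by rewrite /= leNgt tu.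
  by rewrite lt0_exponential_pdf ?mule0// subr_lt0.
have mt : measurable_fun [set: RT] (fun t : RT => 1 * t - u : RT).
  by apply: measurable_funB => //; exact: measurable_funM.
have me : measurable_fun [set: RT] (fun t : RT => (exponential_pdf 1 t)%:E).
  by apply/measurable_EFinP; exact: measurable_exponential_pdf.
rewrite ge0_integralZl//; last 2 first.
- exact: (measurableT_comp me mt).
- by move=> x _; rewrite lee_fin exponential_pdf_ge0.
rewrite (@ge0_integral_affine _ (fun t => (exponential_pdf 1 t)%:E))//.
- by rewrite integral_exponential_pdf// invr1 !mul1e mule1.
- by move=> x; rewrite lee_fin exponential_pdf_ge0.
Qed.

Definition ellipsoid n (B : 'M[R]_n) (r : R) : set 'rV[R]_n := [set x | qform B x <= r].

Lemma measurable_ellipsoid n (B : 'M[R]_n) r : measurable_vset (ellipsoid B r).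
Proof.
rewrite /measurable_vset /ellipsoid/= -[X in measurable X]setTI.
by apply: measurable_fun_le => //; exact: measurable_qform.
Qed.

Lemma posdef_scalar n (a : R) : 0 < a -> posdef (a%:M : 'M[R]_n).
Proof.
move=> a0; split=> [|x x0]; first by rewrite tr_scalar_mx.
rewrite /qform mul_mx_scalar -scalemxAl mxE mulr_gt0//.
rewrite mxE lt_neqAle sumr_ge0 ?andbT => [|i _]; last by rewrite mxE -expr2 sqr_ge0.
apply: contra x0; rewrite eq_sym psumr_eq0 => [/allP h|i _]; last first.
  by rewrite mxE -expr2 sqr_ge0.
apply/eqP/rowP => i; have := h i; rewrite mem_index_enum mxE -expr2 sqrf_eq0.
by move=> /(_ isT)/eqP ->; rewrite mxE.
Qed.

Lemma volume_ellipsoid_scale n (B : 'M[R]_n) r : 0 < r ->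
  volume (ellipsoid B r) = ((r `^ (n%:R / 2))%:E * volume (ellipsoid B 1))%E.
Proof.
move=> r0; have s0 : 0 < Num.sqrt r by rewrite sqrtr_gt0.
rewrite !volume_vint; [|exact: measurable_ellipsoid..].
have i0 : 0 < (Num.sqrt r)^-1 by rewrite invr_gt0.
transitivity (vint (fun x =>
    (\1_(ellipsoid B 1) (x *m (Num.sqrt r)^-1%:M + 0))%:E)).
  apply: eq_vint => x; rewrite !indicE; congr ((nat_of_bool _)%:R%:E).
  rewrite addr0 mul_mx_scalar; apply/idP/idP; rewrite !inE /ellipsoid/=;
    by rewrite qformZ exprVn (sqr_sqrtr (ltW r0)) mulrC ler_pdivrMr// mul1r.
rewrite (vint_affine _ (f := fun x => (\1_(ellipsoid B 1) x)%:E)).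
- rewrite det_scalar exprVn invrK; congr (_%:E * _)%E.
  by rewrite mulrC powRrM (powR12_sqrt (ltW r0)) (powR_mulrn _ (ltW s0)).
- exact: posdef_scalar.
- exact: (vmeas_indic (measurable_ellipsoid B 1)).
- by move=> x; rewrite lee_fin.
Qed.

(** Tonelli for the region [qform B x <= t], weighted by exp(-t). *)
Lemma vint_layer_cake n (B : 'M[R]_n) : posdef B ->
  vint (fun x => (expR (- qform B x))%:E) =
  (\int[mu]_t ((expR (- t))%:E * volume (ellipsoid B t)) )%E /\
  measurable_fun [set: RT] (fun t => (expR (- t))%:E * volume (ellipsoid B t))%E.
Proof.
move=> pB.
pose F (z : n.-tuple RT * RT) : \bar R :=
  (expR (- z.2) * \1_[set z : n.-tuple RT * RT | qform B (vec z.1) <= z.2] z)%:E.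
have mF : measurable_fun setT F.
  apply/measurable_EFinP; apply: measurable_funM.
    by apply: measurableT_comp => //; exact: measurable_funN.
  apply: measurable_indic; rewrite -[X in measurable X]setTI.
  apply: measurable_fun_le => //.
  exact: (measurableT_comp (measurable_qform B) measurable_fst).
have F0 z : (0 <= F z)%E by rewrite lee_fin mulr_ge0 ?expR_ge0.
have FG t : fubini_G (lebesgue_tuple n) F t =
    ((expR (- t))%:E * volume (ellipsoid B t))%E.
  rewrite /fubini_G volume_vint; last exact: measurable_ellipsoid.
  by rewrite -vintZl ?expR_ge0//; exact: (vmeas_indic (measurable_ellipsoid B t)).
split.
  transitivity (\int[lebesgue_tuple n]_s \int[mu]_t F (s, t))%E.
    apply: eq_integral => s _.
    by rewrite -integral_expR_tail ?posdef_qform_ge0.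
  rewrite (fubini_tonelli F)//; apply: eq_integral => t _; exact: FG.
rewrite (_ : (fun t => _) = fubini_G (lebesgue_tuple n) F).
  exact: (measurable_fun_fubini_tonelli_G F).
by apply/funext => t; rewrite FG.
Qed.

(** By homogeneity the layer [t] has volume t^(n/2) V, so the Gaussian integral equals V times the
    integral defining Gamma(n/2 + 1). Positivity of [Gamma] comes out of the same identity. *)
Lemma volume_ellipsoid n (B : 'M[R]_n) : posdef B ->
  0 < @Gamma R (n%:R / 2 + 1) /\
  volume (ellipsoid B 1) =
    (Num.sqrt (pi ^+ n / \det B) / @Gamma R (n%:R / 2 + 1))%:E.
Proof.
move=> pB; set V := volume _.
pose G := (\int[mu]_(t in `]0%R, +oo[) (t `^ (n%:R / 2 + 1 - 1) * expR (- t))%:E)%E.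
have VG : (V * G = (Num.sqrt (pi ^+ n / \det B))%:E)%E.
  have [+ mH] := vint_layer_cake pB; rewrite vint_gauss// => ->.
  (* Negative levels contribute nothing: there the ellipsoid is empty. *)
  transitivity (\int[mu]_(t in `[0%R, +oo[)
      ((expR (- t))%:E * volume (ellipsoid B t)))%E; last first.
    rewrite [LHS]integral_mkcond; apply: eq_integral => t _.
    rewrite patchE; case: ifPn => //; rewrite notin_setE/= in_itv/= andbT => /negP.
    rewrite -ltNge => t0; rewrite (_ : ellipsoid B t = set0).
      by rewrite /volume (_ : [set _ | _] = set0)// measure0 mule0.
    apply/seteqP; split => // x /=.
    by rewrite /ellipsoid/= leNgt (lt_le_trans t0)// posdef_qform_ge0.
  rewrite -integral_itv_obnd_cbnd; last exact: measurable_funTS.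
  rewrite -ge0_integralZl//; last 3 first.
  - apply: measurable_funTS; apply/measurable_EFinP; apply: measurable_funM.
      exact: measurable_powR.
    by apply: measurableT_comp => //; exact: measurable_funN.
  - by move=> t _; rewrite lee_fin mulr_ge0 ?powR_ge0 ?expR_ge0.
  - exact: measure_ge0.
  apply: eq_integral => t; rewrite inE/= in_itv/= andbT => t0.
  rewrite volume_ellipsoid_scale// addrK EFinM muleC -muleA muleC.
  by rewrite -!muleA; congr (_ * _)%E; rewrite muleC.
have V0 : (0 <= V)%E by exact: measure_ge0.
have G0 : (0 <= G)%E by apply: integral_ge0 => t _; rewrite lee_fin mulr_ge0 ?powR_ge0 ?expR_ge0.
have s0 : 0 < Num.sqrt (pi ^+ n / \det B).
  by rewrite sqrtr_gt0 divr_gt0 ?exprn_gt0 ?pi_gt0// det_posdef.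
rewrite /Gamma /Rintegral -/G.
(* The product of the two factors is finite and positive, so neither is infinite; in particular
   [Gamma] is the true value of the integral, not a default one. *)
move: V G VG V0 G0 => [v| |] [g| |]//= VG V0 G0.
- move: VG => -[VG]; rewrite !lee_fin in V0 G0.
  have g0 : 0 < g.
    rewrite lt_neqAle G0 andbT eq_sym; apply/eqP => g0.
    by move: s0; rewrite -VG g0 mulr0 ltxx.
  by split=> //; rewrite -VG mulfK// gt_eqF.
- move: V0 VG; rewrite lee_fin mulr_infty; case: sgrP => [_ _|v0 _|//].
    by rewrite mul0e => -[E]; move: s0; rewrite -E ltxx.
  by rewrite mul1e.
- move: G0 VG; rewrite lee_fin mulyr; case: sgrP => [_ _|g0 _|//].
    by rewrite mul0e => -[E]; move: s0; rewrite -E ltxx.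
  by rewrite mul1e.
Qed.

End ellipsoid.

(** * Gram matrices, Cauchy-Binet and leverage scores *)

Section gram.
Context {R : realType}.

(** Each row of the product is a combination of rows of [B]; expand by multilinearity of the
    determinant. *)
Lemma det_mulmx_expand m n (A : 'M[R]_(n, m)) (B : 'M[R]_(m, n)) :
  \det (A *m B) =
  \sum_(f : {ffun 'I_n -> 'I_m}) (\prod_i A i (f i)) * \det (rowsub f B).
Proof.
rewrite /determinant.
transitivity (\sum_(s : 'S_n) \sum_(f : {ffun 'I_n -> 'I_m})
    (\prod_i A i (f i)) * ((-1) ^+ s * \prod_i rowsub f B i (s i))).
  apply: eq_bigr => s _.
  transitivity ((-1) ^+ s * \prod_i \sum_j A i j * B j (s i)).
    by congr (_ * _); apply: eq_bigr => i _; rewrite mxE.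
  rewrite bigA_distr_bigA big_distrr/=; apply: eq_bigr => f _.
  rewrite mulrCA; congr (_ * _); rewrite -big_split/=.
  by apply: eq_bigr => i _; rewrite mxE.
by rewrite exchange_big; apply: eq_bigr => f _; rewrite big_distrr.
Qed.

(** This is sum_j t_j w_j^T w_j for the rows w_j of [W]; unit weights give the matrix M of the
    selected normals. *)
Definition gram s n (W : 'M[R]_(s, n)) (t : 'I_s -> R) : 'M[R]_n :=
  W^T *m diag_mx (\row_j t j) *m W.

(* The Cauchy-Binet formula, as a sum over all maps: a set of n rows is counted
   n! times, and maps that are not injective contribute 0. *)
Lemma det_gram s n (W : 'M[R]_(s, n)) (t : 'I_s -> R) :
  (n`!)%:R * \det (gram W t) =
  \sum_(f : {ffun 'I_n -> 'I_s}) (\prod_k t (f k)) * \det (rowsub f W) ^+ 2.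
Proof.
(* Every [S p] is the same determinant, expanded and reindexed by [p]; when all of them are added,
   the signed products assemble into a second factor [\det (rowsub f W)]. *)
pose S (p : 'S_n) := \sum_(f : {ffun 'I_n -> 'I_s})
  (\prod_k t (f k)) * ((-1) ^+ p * \prod_k W (f (p k)) k) * \det (rowsub f W).
have SE p : S p = \det (gram W t).
  rewrite /gram det_mulmx_expand /S.
  rewrite (reindex_inj (h := fun f : {ffun 'I_n -> 'I_s} =>
      [ffun k => f (p^-1%g k)]))/=; last first.
    move=> f g /ffunP E; apply/ffunP => k.
    by have := E (p k); rewrite !ffunE permK.
  apply: eq_bigr => f _.
  have -> : rowsub [ffun k => f (p^-1%g k)] W = row_perm p^-1 (rowsub f W).
    by apply/matrixP => i j; rewrite !mxE ffunE.
  rewrite row_permE det_mulmx det_perm odd_permV.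
  have -> : \prod_k t ([ffun k => f (p^-1%g k)] k) = \prod_k t (f k).
    rewrite (reindex_inj (@perm_inj _ p)); apply: eq_bigr => k _.
    by rewrite ffunE permK.
  have -> : \prod_k W ([ffun k0 => f (p^-1%g k0)] (p k)) k = \prod_k W (f k) k.
    by apply: eq_bigr => k _; rewrite ffunE permK.
  have -> : \prod_i (W^T *m diag_mx (\row_j t j)) i (f i) =
      \prod_k W (f k) k * \prod_k t (f k).
    rewrite -big_split/=; apply: eq_bigr => k _.
    by rewrite mul_mx_diag !mxE.
  have E : (-1) ^+ p * (-1) ^+ p = 1 :> R by rewrite -expr2 sqrr_sign.
  move: (\prod_k t (f k)) (\prod_k W (f k) k) (\det (rowsub f W)) => x y z.
  move: ((-1) ^+ p) E => e E.
  by transitivity (e * e * (x * y * z)); [|rewrite E]; ring.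
transitivity (\sum_(p : 'S_n) S p).
  rewrite (eq_bigr (fun=> \det (gram W t))) => [|p _]; last exact: SE.
  by rewrite sumr_const mulr_natl; congr (_ *+ _); rewrite -card_Sn.
rewrite /S exchange_big; apply: eq_bigr => f _.
rewrite -big_distrl/= -big_distrr/= -mulrA expr2; congr (_ * (_ * _)).
rewrite -det_tr /determinant; apply: eq_bigr => p _; congr (_ * _).
by apply: eq_bigr => k _; rewrite !mxE.
Qed.

Lemma mulmx_trE s n (W : 'M[R]_(s, n)) (x : 'rV[R]_n) j :
  (x *m W^T) ord0 j = inner x (row j W).
Proof. by rewrite mxE; apply: eq_bigr => i _; rewrite !mxE. Qed.

Lemma qform_gram s n (W : 'M[R]_(s, n)) (t : 'I_s -> R) x :
  qform (gram W t) x = \sum_j t j * inner x (row j W) ^+ 2.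
Proof.
rewrite /qform /gram !mulmxA -(mulmxA _ W) -[W *m _]trmxK trmx_mul trmxK.
rewrite mul_mx_diag mxE; apply: eq_bigr => j _.
by rewrite mxE [_^T _ _]mxE mulmx_trE mxE expr2 mulrAC mulrC.
Qed.

Lemma tr_gram s n (W : 'M[R]_(s, n)) t : (gram W t)^T = gram W t.
Proof. by rewrite /gram !trmx_mul trmxK tr_diag_mx mulmxA. Qed.

(** The matrix determinant lemma: one matrix of size n + 1 is factored in two ways into block
    triangular matrices. *)
Lemma det_rank_one_update n (M : 'M[R]_n) (u : 'rV[R]_n) c : M \in unitmx ->
  \det (M + c *: (u^T *m u)) = \det M * (1 + c * qform (invmx M) u).
Proof.
move=> uM.
have E : block_mx 1%:M (- (c *: u^T)) 0 (1%:M : 'M[R]_1) *m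
    block_mx (M + c *: (u^T *m u)) 0 u 1%:M =
    block_mx 1%:M 0 (u *m invmx M) 1%:M *m
    block_mx M (- (c *: u^T)) 0 (1%:M + c *: (u *m invmx M *m u^T)).
  rewrite !mulmx_block ?mul0mx ?mul1mx ?mulmx0 ?mulmx1 ?addr0 ?add0r.
  congr block_mx.
  - by rewrite mulNmx -scalemxAl addrK.
  - by rewrite -mulmxA mulVmx// mulmx1.
  - by rewrite mulmxN -scalemxAr addrCA addNr addr0.
have := congr1 determinant E.
rewrite !det_mulmx !det_ublock !det_lblock !det1 !mul1r !mulr1 => ->.
by congr (_ * _); rewrite det_mx11 /qform !mxE.
Qed.

Lemma posdef_unitmx n (M : 'M[R]_n) : posdef M -> M \in unitmx.
Proof. by move=> /det_posdef d0; rewrite unitmxE unitfE gt_eqF. Qed.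

Lemma inner_mulmx n (x w : 'rV[R]_n) : inner x w = (x *m w^T) ord0 ord0.
Proof. by rewrite mxE; apply: eq_bigr => i _; rewrite mxE. Qed.

Lemma qform_mul_inv n (M : 'M[R]_n) x : M^T = M -> M \in unitmx ->
  qform M (x *m invmx M) = qform (invmx M) x.
Proof.
move=> sM uM; rewrite /qform trmx_mul trmx_inv sM -!mulmxA (mulmxA M) mulmxV//.
by rewrite mul1mx.
Qed.

Lemma posdef_inv n (M : 'M[R]_n) : posdef M -> posdef (invmx M).
Proof.
move=> pM; have uM := posdef_unitmx pM; have [sM M0] := pM.
split; first by rewrite trmx_inv sM.
move=> x x0.
rewrite -qform_mul_inv//.
apply: M0; apply: contra x0 => /eqP E.
by rewrite -[x]mulmx1 -(mulVmx uM) mulmxA E mul0mx.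
Qed.

Lemma qform_sub_inv n (M : 'M[R]_n) (a b : R) x w : posdef M ->
  qform M (a *: x - b *: (w *m invmx M)) =
  a ^+ 2 * qform M x - 2 * a * b * inner x w + b ^+ 2 * qform (invmx M) w.
Proof.
move=> pM; have uM := posdef_unitmx pM; have [sM _] := pM.
have E1 : x *m w^T = (inner x w)%:M.
  by apply/matrixP => i j; rewrite !ord1 inner_mulmx [RHS]mxE eqxx mulr1n.
have E2 : w *m x^T = (inner x w)%:M.
  by rewrite -[LHS]trmxK trmx_mul trmxK E1 tr_scalar_mx.
rewrite /qform [(_ - _)^T]linearB/= [(_ *: x)^T]linearZ/=.
rewrite [(_ *: (w *m _))^T]linearZ/= mulmxBl -!scalemxAl.
rewrite -(mulmxA w) mulVmx// mulmx1 trmx_mul trmx_inv sM.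
rewrite mulmxBr !mulmxBl -!scalemxAl -!scalemxAr !(mulmxA _ (invmx M)).
rewrite -(mulmxA x M (invmx M)) mulmxV// mulmx1 E1 E2 !mxE eqxx !mulr1n.
ring.
Qed.

(** Cauchy-Schwarz for the norm of [M] and its dual, from nonnegativity of the form at z x - p w
    M^-1. *)
Lemma inner_sqr_le n (M : 'M[R]_n) x w : posdef M ->
  inner x w ^+ 2 <= qform M x * qform (invmx M) w.
Proof.
move=> pM; have uM := posdef_unitmx pM.
have [->|w0] := eqVneq w 0.
  by rewrite inner_mulmx trmx0 mulmx0 /qform !mul0mx !(mxE const_mx_key) expr0n mulr0.
have z0 := (posdef_inv pM).2 w w0.
set z := qform _ w in z0 *; set p := inner x w; set A := qform M x.
have : 0 <= qform M (z *: x - p *: (w *m invmx M)) by exact: posdef_qform_ge0.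
have -> : qform M (z *: x - p *: (w *m invmx M)) = z * (A * z - p ^+ 2).
  rewrite qform_sub_inv// -/p -/z -/A; ring.
by rewrite pmulr_rge0// subr_ge0.
Qed.

(** Least squares: with y = b W M^-1, the numbers <y, w_j> are the orthogonal projection of [b],
    whose squared norm is the left-hand side. *)
Lemma qform_inv_gram_le s n (W : 'M[R]_(s, n)) (b : 'rV[R]_s) :
  let M := gram W (fun=> 1) in posdef M ->
  qform (invmx M) (b *m W) <= \sum_j b ord0 j ^+ 2.
Proof.
move=> M pM; have uM := posdef_unitmx pM; have [sM _] := pM.
set v := b *m W; set y := v *m invmx M.
have : 0 <= \sum_j (b ord0 j - inner y (row j W)) ^+ 2.
  by apply: sumr_ge0 => j _; exact: sqr_ge0.
have E1 : \sum_j inner y (row j W) ^+ 2 = qform (invmx M) v.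
  transitivity (qform M y).
    by rewrite qform_gram; apply: eq_bigr => j _; rewrite mul1r.
  exact: qform_mul_inv.
have E2 : \sum_j b ord0 j * inner y (row j W) = qform (invmx M) v.
  rewrite /qform -[v *m invmx M]/y /v trmx_mul mulmxA mxE.
  apply: eq_bigr => j _; rewrite [b^T _ _]mxE mulrC; congr (_ * _).
  by rewrite inner_mulmx !mxE; apply: eq_bigr => k _; rewrite !mxE.
have -> : \sum_j (b ord0 j - inner y (row j W)) ^+ 2 =
    \sum_j b ord0 j ^+ 2 - 2 * \sum_j b ord0 j * inner y (row j W) +
    \sum_j inner y (row j W) ^+ 2.
  rewrite mulr_sumr -sumrB -big_split/=; apply: eq_bigr => j _; ring.
rewrite E1 E2; lra.
Qed.

Lemma posdef_gram s n (W : 'M[R]_(s, n)) (t : 'I_s -> R) :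
  gram W (fun=> 1) \in unitmx -> (forall j, 0 < t j) -> posdef (gram W t).
Proof.
move=> uM t0; split=> [|x x0]; first exact: tr_gram.
rewrite qform_gram lt_neqAle sumr_ge0 ?andbT => [|j _]; last first.
  by rewrite mulr_ge0 ?sqr_ge0// ltW.
apply: contra x0; rewrite eq_sym psumr_eq0 => [/allP h|j _]; last first.
  by rewrite mulr_ge0 ?sqr_ge0// ltW.
have E : x *m W^T = 0.
  apply/rowP => j; have := h j; rewrite mem_index_enum => /(_ isT).
  by rewrite mulf_eq0 gt_eqF//= sqrf_eq0 mulmx_trE => /eqP ->; rewrite mxE.
by rewrite -[x](mulmxK uM) /gram !mulmxA E !mul0mx.
Qed.

(** The exponential lies above its tangent at the mean [m]. *)
Lemma expR_weighted_amgm (I : finType) (p L : I -> R) :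
  (forall i, 0 <= p i) -> \sum_i p i = 1 ->
  expR (\sum_i p i * L i) <= \sum_i p i * expR (L i).
Proof.
move=> p0 p1; set m := \sum_i p i * L i.
have : \sum_i p i * (expR m * (1 + (L i - m))) <= \sum_i p i * expR (L i).
  apply: ler_sum => i _; apply: ler_wpM2l => //.
  have -> : expR (L i) = expR m * expR (L i - m) by rewrite -expRD addrC subrK.
  by rewrite ler_wpM2l ?expR_ge0// expR_ge1Dx.
have -> : \sum_i p i * (expR m * (1 + (L i - m))) =
    expR m * (\sum_i p i + (m - (\sum_i p i) * m)).
  rewrite mulr_suml -sumrB -big_split/= mulr_sumr; apply: eq_bigr => i _; ring.
by rewrite p1 mul1r subrr addr0 mulr1.
Qed.

(** The diagonal of the orthogonal projection W M^-1 W^T; these numbers act as the exponents of the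
    Brascamp-Lieb inequality and add up to n. *)
Definition leverage s n (W : 'M[R]_(s, n)) j :=
  qform (invmx (gram W (fun=> 1))) (row j W).

Lemma gramD1 s n (W : 'M[R]_(s, n)) j (t : 'I_s -> R) c :
  gram W (fun i => t i + c * (i == j)%:R) = gram W t + c *: ((row j W)^T *m row j W).
Proof.
rewrite /gram; apply/matrixP => a b.
rewrite !mxE; under eq_bigr do rewrite mul_mx_diag !mxE.
under [in RHS]eq_bigr do rewrite mul_mx_diag !mxE.
rewrite big_ord1 !mxE (eq_bigr (fun k => W k a * t k * W k b + c * (W k a * W k b) * (k == j)%:R)).
  rewrite big_split/=; congr (_ + _).
  rewrite (bigD1 j)//= eqxx mulr1 big1 ?addr0// => k /negPf ->.
  by rewrite mulr0.
by move=> k _; ring.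
Qed.

Lemma sum_qform_row s n (A : 'M[R]_n) (W : 'M[R]_(s, n)) :
  \sum_j qform A (row j W) = \tr (A *m gram W (fun=> 1)).
Proof.
transitivity (\tr (W *m A *m W^T)).
  apply: eq_bigr => j _; rewrite /qform -row_mul !mxE.
  by apply: eq_bigr => k _; rewrite !mxE.
rewrite -mulmxA mxtrace_mulC -mulmxA; congr (\tr (_ *m _)).
rewrite /gram (_ : diag_mx _ = 1%:M) ?mulmx1//.
by apply/matrixP => i k; rewrite !mxE.
Qed.

Lemma sum_leverage s n (W : 'M[R]_(s, n)) : gram W (fun=> 1) \in unitmx ->
  \sum_j leverage W j = n%:R.
Proof. by move=> uM; rewrite /leverage sum_qform_row mulVmx// mxtrace1. Qed.

(** Cauchy-Binet makes [p] a probability on choices of n rows. The expected number of occurrences of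
    row j is read off from the change of the determinant when the weight of that row is doubled. *)
Lemma leverage_weights s n (W : 'M[R]_(s, n)) (M := gram W (fun=> 1))
  (p := fun f : {ffun 'I_n -> 'I_s} => \det (rowsub f W) ^+ 2 / ((n`!)%:R * \det M)) :
  M \in unitmx ->
  \sum_f p f = 1 /\
  forall j, \sum_f p f * (\sum_k (f k == j)%:R) = leverage W j.
Proof.
move=> uM.
have n0 : (n`!)%:R != 0 :> R by rewrite pnatr_eq0 -lt0n fact_gt0.
have d0 : \det M != 0 by rewrite -unitfE -unitmxE.
have nd0 : (n`!)%:R * \det M != 0 by rewrite mulf_neq0.
have p1 : \sum_f p f = 1.
  rewrite -mulr_suml; apply: (canLR (mulfK nd0)); rewrite mul1r det_gram.
  by apply: eq_bigr => f _; rewrite big1 ?mul1r.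
split=> // j.
have E := det_rank_one_update (row j W) 1 uM.
rewrite -gramD1 mul1r -/(leverage W j) in E.
(* Doubling the weight of row [j] doubles the term of an injective [f] that takes the value [j] and
   keeps the other terms; for [f] not injective the determinant vanishes. *)
have : \sum_f p f * (1 + \sum_k (f k == j)%:R) = 1 + leverage W j.
  transitivity (\det (gram W (fun i => 1 + 1 * (i == j)%:R)) / \det M); last first.
    by rewrite E mulrC mulKf.
  apply: (mulIf nd0); rewrite [RHS]mulrCA divfK// [RHS]det_gram mulr_suml.
  apply: eq_bigr => f _; rewrite mulrAC /p divfK// mulrC.
  have [->|fW] := eqVneq (\det (rowsub f W)) 0; first by rewrite expr0n/= !mulr0.
  congr (_ * _).
  have finj : injective f.
    move=> a b fab; apply/eqP; apply: contraNT fW => ab.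
    rewrite (determinant_alternate ab)// => k; by rewrite !mxE fab.
  have [/existsP[k /eqP fk]|/existsPn nj] := boolP [exists k, f k == j].
    rewrite (bigD1 k)//= [RHS](bigD1 k)//= fk eqxx mulr1 big1 => [|i ik].
      rewrite addr0 big1 ?mulr1// => i ik.
      by rewrite -fk (inj_eq finj) (negPf ik) mulr0 addr0.
    by rewrite -fk (inj_eq finj) (negPf ik).
  rewrite big1 => [|k _]; last by rewrite (negPf (nj k)).
  by rewrite addr0 big1// => k _; rewrite (negPf (nj k)) mulr0 addr0.
under eq_bigr do rewrite mulrDr mulr1.
by rewrite big_split/= p1 => /addrI.
Qed.

(* By Cauchy-Binet, det (gram W t) / det M is a weighted mean of the products of n
   of the t j, in which t j occurs with total weight leverage W j. *)
Lemma det_gram_ge s n (W : 'M[R]_(s, n)) (t : 'I_s -> R) :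
  let M := gram W (fun=> 1) in M \in unitmx -> (forall j, 0 < t j) ->
  \det M * expR (\sum_j leverage W j * ln (t j)) <= \det (gram W t).
Proof.
move=> M uM t0.
pose p (f : {ffun 'I_n -> 'I_s}) := \det (rowsub f W) ^+ 2 / ((n`!)%:R * \det M).
have p1 : \sum_f p f = 1 by exact: (leverage_weights uM).1.
have pl j : \sum_f p f * (\sum_k (f k == j)%:R) = leverage W j.
  exact: (leverage_weights uM).2.
have d0 : 0 < \det M by apply/det_posdef/posdef_gram.
have nf0 : 0 < (n`!)%:R :> R by rewrite ltr0n fact_gt0.
have p0 f : 0 <= p f by rewrite divr_ge0 ?sqr_ge0// mulr_ge0// ltW.
have := expR_weighted_amgm (fun f : {ffun 'I_n -> 'I_s} => \sum_k ln (t (f k))) p0 p1.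
have -> : \sum_f p f * (\sum_k ln (t (f k))) = \sum_j leverage W j * ln (t j).
  under [RHS]eq_bigr do rewrite -pl mulr_suml.
  rewrite exchange_big/=; apply: eq_bigr => f _.
  under [RHS]eq_bigr do rewrite -mulrA.
  rewrite -mulr_sumr; congr (_ * _).
  under [RHS]eq_bigr do rewrite mulr_suml.
  rewrite exchange_big/=; apply: eq_bigr => k _.
  rewrite (bigD1 (f k))//= eqxx mul1r big1 ?addr0// => j /negPf jk.
  by rewrite eq_sym jk mul0r.
have -> : \sum_f p f * expR (\sum_k ln (t (f k))) = \det (gram W t) / \det M.
  have dN0 : \det M != 0 by rewrite gt_eqF.
  have nd0 : (n`!)%:R * \det M != 0 by rewrite mulf_neq0// gt_eqF.
  apply: (mulIf nd0); rewrite [RHS]mulrCA divfK// [RHS]det_gram mulr_suml.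
  apply: eq_bigr => f _; rewrite mulrAC /p divfK// mulrC; congr (_ * _).
  rewrite expR_sum; apply: eq_bigr => k _; rewrite lnK//; exact: t0.
by rewrite ler_pdivlMr// mulrC.
Qed.

End gram.

(** * Construction of the piecewise affine transport *)

Section gauss_steps.
Import gauss_integral_proof.
Context {R : realType}.
Local Notation RT := (measurableTypeR R).
Local Notation mu := (@lebesgue_measure R).

Lemma gauss_fun_le (x y : R) : y ^+ 2 <= x ^+ 2 -> gauss_fun x <= gauss_fun y.
Proof. by move=> xy; rewrite /gauss_fun ler_expR lerN2. Qed.

Lemma integral_gauss_upper_sum (e : R) M : 0 < e ->
  (\int[mu]_(x in `[0%R, (M%:R * e)%R]) (gauss_fun x)%:E <=
   (e * \sum_(j < M) gauss_fun (j%:R * e))%:E)%E.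
Proof.
move=> e0; have mg D : measurable_fun (D : set RT) (fun x => (gauss_fun x)%:E).
  by apply: measurable_funTS; apply/measurable_EFinP; exact: measurable_gauss_fun.
elim: M => [|M IH].
  by rewrite mul0r set_itv1 integral_set1 big_ord0 mulr0.
have Me : 0 <= M%:R * e by rewrite mulr_ge0// ltW.
have MSe : M%:R * e <= M.+1%:R * e by rewrite ler_pM2r// ler_nat.
rewrite (@itv_bndbnd_setU _ _ _ (BRight (M%:R * e)))//.
rewrite ge0_integral_setU//=; last 2 first.
- by move=> x _; rewrite lee_fin gauss_fun_ge0.
- by apply/disj_setPS => x [/=]; rewrite !in_itv/= => /andP[_ xM] /andP[];
    rewrite ltNge xM.
rewrite big_ord_recr/= mulrDr EFinD; apply: leeD => //.
apply: (@le_trans _ _ (\int[mu]_(x in `](M%:R * e)%R, (M.+1%:R * e)%R])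
   (gauss_fun (M%:R * e))%:E)%E).
  apply: ge0_le_integral => //.
  - by move=> x _; rewrite lee_fin gauss_fun_ge0.
  - move=> x /=; rewrite in_itv/= => /andP[xM _]; rewrite lee_fin.
    by apply: gauss_fun_le; rewrite ler_sqr ?nnegrE// ?ltW// (le_lt_trans Me).
rewrite integral_cst//= lebesgue_measure_itv/= lte_fin ltr_pM2r// ltr_nat ltnS leqnn.
by rewrite -EFinD -EFinM lee_fin mulrC -mulrBl -natr1 addrAC subrr add0r mul1r.
Qed.

(** Left endpoint sums dominate the integral over [0, X], which comes close to sqrt(pi) / 2; passing
    to right endpoints costs at most one mesh [e]. *)
Lemma gauss_lower_sum (c : R) : 0 <= c -> c < Num.sqrt pi / 2 ->
  exists e M, 0 < e /\ c < e * \sum_(j < M) gauss_fun (j.+1%:R * e).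
Proof.
move=> c0 cpi; pose v := (c + Num.sqrt pi / 2) / 2.
have cv : c < v by rewrite /v; lra.
have v0 : 0 < v by exact: le_lt_trans cv.
(* The Gaussian limit is available for the square of the integral, so squares are compared. *)
have vpi : v ^+ 2 < pi / 4.
  have -> : pi / 4 = (Num.sqrt pi / 2) ^+ 2 :> R.
    by rewrite exprMn sqr_sqrtr ?pi_ge0// exprVn; congr (_ / _); rewrite -natrX.
  by rewrite ltr_sqr ?nnegrE ?divr_ge0 ?sqrtr_ge0 ?ltW// /v; lra.
have [X [X0 vX]] : exists X, 0 < X /\ v < integral0_gauss X.
  have nv : \forall x \near +oo, v ^+ 2 < @integral0_gauss R x ^+ 2.
    exact: (cvgr_gt _ (@cvg_integral0_gauss_sqr R)).
  have [X [X0 vX]] := filter_ex (filterI (nbhs_pinfty_gt (real0 R)) nv).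
  exists X; split => //.
  by move: vX; rewrite ltr_sqr ?nnegrE ?integral0_gauss_ge0// ltW.
(* So many points that the mesh X / M is below the margin v - c. *)
pose M := (Num.truncn (X / (v - c))).+1.
have M0 : 0 < M%:R :> R by rewrite ltr0n.
have MX : X / (v - c) < M%:R by exact: truncnS_gt.
pose e := X / M%:R; have e0 : 0 < e by rewrite divr_gt0.
exists e, M; split=> //.
have ev : e < v - c.
  by rewrite /e ltr_pdivrMr// mulrC -ltr_pdivrMr// subr_gt0.
have := integral_gauss_upper_sum M e0; rewrite mulrC divfK ?gt_eqF// => I1.
have : v < e * \sum_(j < M) gauss_fun (j%:R * e).
  rewrite -lte_fin; apply: lt_le_trans I1.
  have i0 : (0 <= \int[mu]_(x in `[0%R, X]) (gauss_fun x)%:E)%E.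
    by apply: integral_ge0 => x _; rewrite lee_fin gauss_fun_ge0.
  move: vX; rewrite /integral0_gauss /Rintegral.
  by case: (integral _ _ _) i0 => [r _|_ _|//]; rewrite ?lte_fin ?ltry.
have : \sum_(j < M) gauss_fun (j%:R * e) <= 1 + \sum_(j < M) gauss_fun (j.+1%:R * e).
  rewrite /M big_ord_recl big_ord_recr/= lerD//.
    by rewrite mul0r /gauss_fun expr0n/= oppr0 expR0.
  by rewrite lerDl gauss_fun_ge0.
move=> h1 h2.
have : e * \sum_(j < M) gauss_fun (j%:R * e) <=
    e * (1 + \sum_(j < M) gauss_fun (j.+1%:R * e)).
  by rewrite ler_pM2l.
rewrite mulrDr mulr1; lra.
Qed.

(* The increasing piecewise affine map T x = t i * x + b i (a i <= x <= a i.+1)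
   replaces the transport of the uniform measure of [-1, 1] to the Gaussian: k is
   slightly less than the value of T' * exp (- T^2) for the exact transport. *)
Lemma gauss_steps (k : R) : 0 < k -> k < Num.sqrt pi / 2 ->
  exists (N : nat) (a t b : nat -> R),
  [/\ a 0 = -1, 1 < a N, (forall i, a i < a i.+1) &
      forall i, [/\ 0 < t i, t i * a i.+1 + b i = t i.+1 * a i.+1 + b i.+1 &
       forall x, a i <= x <= a i.+1 -> k <= t i * gauss_fun (t i * x + b i)]].
Proof.
move=> k0 kpi.
have [e [M [e0 ke]]] := gauss_lower_sum (ltW k0) kpi.
(* Breakpoints of the image: a grid of mesh [e] from -M e to M e. The source cell mapped onto the
   i-th image cell gets length e m_i / k, where m_i is the minimum of the Gaussian on the image
   cell, so its slope is k / m_i. *)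
pose be (i : nat) : R := (i%:R - M%:R) * e.
pose m i := Num.min (gauss_fun (be i)) (gauss_fun (be i.+1)).
have m0 i : 0 < m i by rewrite lt_min !expR_gt0.
pose a (i : nat) := -1 + \sum_(j < i) (e * m j / k).
pose t i := k / m i.
have t0 i : 0 < t i by rewrite divr_gt0.
have aS i : a i.+1 = a i + e * m i / k by rewrite /a big_ord_recr/= addrA.
have tE i : t i * (e * m i / k) = e.
  by rewrite /t; field; rewrite !gt_eqF.
have beS i : be i.+1 = be i + e by rewrite /be -natr1; ring.
exists (M + M)%N, a, t, (fun i => be i - t i * a i); split.
- by rewrite /a big_ord0 addr0.
- rewrite /a -mulr_suml -mulr_sumr big_split_ord/=.
  (* On the positive half the minimum is at the right endpoint; [S2] is the mirror image. Each half
     then has source length greater than 1. *)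
  have S1 : \sum_(i < M) gauss_fun (i.+1%:R * e) <= \sum_(i < M) m (M + i)%N.
    have E (i : nat) : be (M + i)%N = i%:R * e by rewrite /be natrD; ring.
    apply: ler_sum => i _; rewrite /m -addnS !E le_min lexx andbT gauss_fun_le//.
    by have : 0 <= i%:R * e; [rewrite mulr_ge0// ltW|rewrite -natr1; nra].
  have S2 : \sum_(i < M) gauss_fun (i.+1%:R * e) <= \sum_(i < M) m i.
    rewrite (reindex_inj rev_ord_inj)/=; apply: ler_sum => i _.
    have iM : (i.+1%:R <= M%:R :> R) by rewrite ler_nat.
    rewrite /m /be subnSK// natrB 1?ltnW//.
    rewrite le_min; apply/andP; split; apply: gauss_fun_le; rewrite -?natr1; nra.
  have : 2 < e * (\sum_(i < M) m i + \sum_(i < M) m (M + i)%N) / k.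
    rewrite ltr_pdivlMr//.
    have : e * \sum_(i < M) gauss_fun (i.+1%:R * e) <= e * \sum_(i < M) m i by rewrite ler_pM2l.
    have : e * \sum_(i < M) gauss_fun (i.+1%:R * e) <= e * \sum_(i < M) m (M + i)%N.
      by rewrite ler_pM2l.
    lra.
  lra.
- by move=> i; rewrite aS ltrDl divr_gt0// mulr_gt0.
- move=> i; split=> //.
    rewrite beS [in RHS]addrC subrK aS mulrDr tE; ring.
  move=> x /andP[ax xa].
  have : m i <= gauss_fun (t i * x + (be i - t i * a i)).
    set y := _ + _.
    have y1 : be i <= y.
      by rewrite /y addrCA lerDl -mulrBr mulr_ge0 ?subr_ge0// ltW.
    have y2 : y <= be i.+1.
      rewrite beS /y addrCA lerD2l -mulrBr -(tE i) ler_pM2l// lerBlDl.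
      by rewrite -aS.
    rewrite ge_min; apply/orP.
    have [y0|y0] := leP 0 y; [right|left]; apply: gauss_fun_le; nra.
  by rewrite -(ler_pM2l (t0 i)) /t divfK ?gt_eqF.
Qed.

End gauss_steps.

(** * Monotonicity of the transport *)

Section step_transport.
Context {R : realType}.
Variables (a t b : nat -> R).
Hypothesis a_incr : forall i, a i < a i.+1.
Hypothesis t_gt0 : forall i, 0 < t i.
Hypothesis glue : forall i, t i * a i.+1 + b i = t i.+1 * a i.+1 + b i.+1.

Let a_le : {homo a : i j / (i <= j)%N >-> i <= j}.
Proof. by apply: homo_leq => // [x y z|i]; [exact: le_trans | exact: ltW]. Qed.

Let bp_le : {homo (fun i => t i * a i + b i) : i j / (i <= j)%N >-> i <= j}.
Proof.
apply: homo_leq => // [x y z|i]; first exact: le_trans.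
by rewrite -glue lerD2r ler_pM2l// ltW.
Qed.

Lemma step_transport_lt i j (x y : R) : a i <= x < a i.+1 -> a j <= y < a j.+1 ->
  x < y -> t i * x + b i < t j * y + b j.
Proof.
move=> /andP[ix xi] /andP[jy yj] xy; have [ij|ji|ij] := ltngtP i j.
- apply: (@lt_le_trans _ _ (t i.+1 * a i.+1 + b i.+1)).
    by rewrite -glue ltrD2r ltr_pM2l.
  apply: (@le_trans _ _ (t j * a j + b j)); first exact: bp_le.
  by rewrite lerD2r ler_pM2l.
- by have := lt_trans xy (lt_le_trans yj (le_trans (a_le ji) ix)); rewrite ltxx.
- by rewrite ij ltrD2r ltr_pM2l.
Qed.

Lemma step_cell_inj i j x : a i <= x < a i.+1 -> a j <= x < a j.+1 -> i = j.
Proof.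
move=> /andP[ix xi] /andP[jx xj]; have [ij|ji|//] := ltngtP i j.
- by have := lt_le_trans xi (le_trans (a_le ij) jx); rewrite ltxx.
- by have := lt_le_trans xj (le_trans (a_le ji) ix); rewrite ltxx.
Qed.

(** Strict monotonicity as a positive product, ready to be summed over the strips in
    [affine_inj]. *)
Lemma step_transport_mono i j (x y : R) : a i <= x < a i.+1 -> a j <= y < a j.+1 ->
  x != y -> 0 < ((t i * x + b i) - (t j * y + b j)) * (x - y).
Proof.
move=> ix jy; rewrite neq_lt => /orP[xy|yx].
- have := step_transport_lt ix jy xy; nra.
- have := step_transport_lt jy ix yx; nra.
Qed.

Lemma step_cell_exists N x : a 0 <= x < a N -> exists i : 'I_N, a i <= x < a i.+1.
Proof.
elim: N => [|N IH] /andP[ax xa]; first by have := le_lt_trans ax xa; rewrite ltxx.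
have [xN|Nx] := ltP x (a N).
  have [|i ai] := IH; first by rewrite ax.
  by exists (widen_ord (leqnSn N) i).
by exists ord_max; rewrite Nx.
Qed.

End step_transport.

(** * Ball's inequality for finitely many strips *)

Section ball.
Context {R : realType}.
Local Notation RT := (measurableTypeR R).

Lemma measurable_inner n (w : 'rV[R]_n) :
  measurable_fun setT (fun x : n.-tuple RT => inner (vec x) w).
Proof.
apply: measurable_sum => j; apply: (@measurable_funM _ _ _ _
  (fun x => vec x ord0 j) (fun=> w ord0 j)) => //.
exact: measurable_vec.
Qed.

Lemma measurable_vset_forall n (I : finType) (A : I -> set 'rV[R]_n) :
  (forall i, measurable_vset (A i)) -> measurable_vset [set x | forall i, A i x].
Proof.
move=> mA; rewrite /measurable_vset.
rewrite (_ : [set _ | _] = \bigcap_(i in [set: I]) [set t | A i (vec t)]).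
  by apply: fin_bigcap_measurable => // i _; exact: mA.
by apply/seteqP; split => x /= h i; [move=> _; exact: h | exact: h].
Qed.

Lemma measurable_inner_itv n (w : 'rV[R]_n) (u v : R) :
  measurable_vset [set x | u <= inner x w < v].
Proof.
rewrite /measurable_vset -[X in measurable X]setTI.
rewrite (_ : [set _ | _] = (fun x => inner (vec x) w) @^-1` `[u, v[%classic).
  by apply: measurable_inner.
by apply/seteqP; split => x /=; rewrite in_itv.
Qed.

Lemma measurable_strip n (w : 'rV[R]_n) : measurable_vset (strip w).
Proof.
rewrite /measurable_vset -[X in measurable X]setTI.
rewrite (_ : [set _ | _] = (fun x => inner (vec x) w) @^-1` `[-1, 1]%classic).
  by apply: measurable_inner.
by apply/seteqP; split => x /=; rewrite in_itv/= /strip/= ler_norml.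
Qed.

Lemma vmeas_EFinP n (g : 'rV[R]_n -> R) :
  vmeas (fun x => (g x)%:E) <->
  measurable_fun setT (fun t : n.-tuple RT => g (vec t)).
Proof. exact: (measurable_EFinP setT (fun t : n.-tuple RT => g (vec t))). Qed.

Lemma vint_sum n (I : finType) (F : I -> 'rV[R]_n -> \bar R) :
  (forall i, vmeas (F i)) -> (forall i x, (0 <= F i x)%E) ->
  vint (fun x => \sum_i F i x)%E = (\sum_i vint (F i))%E.
Proof.
by move=> mF F0; rewrite /vint ge0_integral_sum.
Qed.

(** Convexity of x ln x: the left-hand side is its tangent at [r]. *)
Lemma xlnx_ge (x r : R) : 0 <= x -> 0 < r -> x * (1 + ln r) - r <= x * ln x.
Proof.
rewrite le_eqVlt => /orP[/eqP <-|x0] r0.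
  by rewrite !mul0r sub0r oppr_le0 ltW.
have : ln (r / x) <= r / x - 1.
  have := @le_ln1Dx _ (r / x - 1); rewrite addrCA subrr addr0; apply.
  by rewrite ltrBDl subrr divr_gt0.
rewrite ln_div ?posrE// => h.
have : x * (ln r - ln x) <= x * (r / x - 1) by rewrite ler_pM2l.
have -> : x * (r / x - 1) = r - x by field; rewrite gt_eqF.
lra.
Qed.

Section ball_bound.
Variables (s n : nat) (W : 'M[R]_(s, n)).
Let M := gram W (fun=> 1).
Hypothesis uM : M \in unitmx.
Variables (k : R) (N : nat) (a t b : nat -> R).
Hypothesis k0 : 0 < k.
Hypothesis a_first : a 0 = -1.
Hypothesis a_last : 1 < a N.
Hypothesis a_incr : forall i, a i < a i.+1.
Hypothesis t_gt0 : forall i, 0 < t i.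
Hypothesis glue : forall i, t i * a i.+1 + b i = t i.+1 * a i.+1 + b i.+1.
Hypothesis dens : forall i x, a i <= x <= a i.+1 -> k <= t i * gauss_fun (t i * x + b i).

Let pM : posdef M. Proof. exact: posdef_gram. Qed.

Let q := leverage W.
(* When q j = 0 the j-th row is 0, so any positive value can replace sqrt (q j). *)
Let r j := if q j == 0 then 1 else Num.sqrt (q j).

Let q_ge0 j : 0 <= q j.
Proof. exact/posdef_qform_ge0/posdef_inv. Qed.

Let r_gt0 j : 0 < r j.
Proof.
by rewrite /r; case: ifPn => // qj; rewrite sqrtr_gt0 lt_neqAle eq_sym qj q_ge0.
Qed.

Let row_eq0 j : q j = 0 -> row j W = 0.
Proof.
move=> qj; apply/eqP; apply: contraPT qj => wj.
by apply/eqP; rewrite gt_eqF// (posdef_inv pM).2.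
Qed.

Implicit Type f : {ffun 'I_s -> 'I_N}.

(** On [cell f] the map x -> sum_j r_j T(<x, w_j>) w_j, with T the one-dimensional transport, is the
    affine map [x *m B f + c f]. It carries the strips into the space weighted by the Gaussian
    [h]. *)
Let cell f : set 'rV[R]_n :=
  [set x | forall j, a (f j) <= inner x (row j W) < a (f j).+1].
Let B f := gram W (fun j => r j * t (f j)).
Let y f x : 'rV[R]_s := \row_j (r j * (t (f j) * inner x (row j W) + b (f j))).
Let c f : 'rV[R]_n := (\row_j (r j * b (f j))) *m W.
Let h x := expR (- qform (invmx M) x).

Let pB f : posdef (B f).
Proof. by apply: posdef_gram => // j; rewrite mulr_gt0. Qed.

Let affineE f x : x *m B f + c f = y f x *m W.
Proof.
rewrite /B /c /gram !mulmxA -mulmxDl; congr (_ *m _); apply/rowP => j.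
rewrite mul_mx_diag mxE [in X in X + _]mxE mulmx_trE !mxE; ring.
Qed.

Let mcell f : measurable_vset (cell f).
Proof. by apply: measurable_vset_forall => j; exact: measurable_inner_itv. Qed.

Let c0 := k ^+ n * \det M * expR (\sum_j q j * ln (r j)).

Let c0_gt0 : 0 < c0.
Proof. by rewrite !mulr_gt0 ?expR_gt0 ?exprn_gt0// det_posdef. Qed.

(** [det_gram_ge] bounds the Jacobian below by a product of powers (r_j t_j)^(q_j), and
    [qform_inv_gram_le] bounds [h] below by exp(-sum_j q_j T_j^2). Together they form a product of
    q_j-th powers of the one-dimensional bound [dens], and the q_j add up to n. *)
Let jacobian_ge f x : cell f x -> c0 <= \det (B f) * h (x *m B f + c f).
Proof.
move=> xf.
have h1 : \det M * expR (\sum_j q j * ln (r j * t (f j))) <= \det (B f).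
  by apply: det_gram_ge => // j; rewrite mulr_gt0.
have h2 : expR (- \sum_j q j * (t (f j) * inner x (row j W) + b (f j)) ^+ 2) <=
    h (x *m B f + c f).
  rewrite ler_expR lerN2 affineE.
  (* Using sqrt(q_j) instead of r_j changes only coefficients of zero rows. *)
  pose y' : 'rV[R]_s :=
    \row_j (Num.sqrt (q j) * (t (f j) * inner x (row j W) + b (f j))).
  have -> : y f x *m W = y' *m W.
    apply/rowP => i; rewrite !mxE; apply: eq_bigr => j _; rewrite !mxE /r.
    case: eqP => // /row_eq0/rowP/(_ i); rewrite !mxE => ->.
    by rewrite !mulr0.
  apply: le_trans (qform_inv_gram_le _ pM) _; apply: ler_sum => j _.
  by rewrite mxE exprMn sqr_sqrtr.
have d0 := det_posdef pM.
apply: le_trans (ler_pM (mulr_ge0 (ltW d0) (expR_ge0 _)) (expR_ge0 _) h1 h2).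
rewrite /c0 (mulrC (k ^+ n)) -[leLHS]mulrA -[leRHS]mulrA ler_pM2l// -expRD.
have -> : k ^+ n = expR (\sum_j q j * ln k).
  by rewrite -mulr_suml sum_leverage// expRM_natl lnK.
rewrite -expRD ler_expR -sumrN -!big_split/=; apply: ler_sum => j _.
rewrite -mulrN -!mulrDr ler_wpM2l//.
have tj := t_gt0 (f j); have rj := r_gt0 j.
rewrite lnM// addrC -addrA lerD2l.
have := xf j => /andP[xj jx].
have := dens (i := f j) (x := inner x (row j W)).
rewrite xj ltW// => /(_ isT) kt.
rewrite -[X in _ + X]expRK -lnM ?posrE ?expR_gt0// ler_ln ?posrE ?mulr_gt0 ?expR_gt0//.
Qed.

(** The inner product of the difference of the images with x - z is a sum of nonnegative terms, by
    monotonicity of T. If it is 0, then x and z have the same products with all rows, and the rows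
    span. *)
Let affine_inj f g x z : cell f x -> cell g z ->
  x *m B f + c f = z *m B g + c g -> x = z.
Proof.
move=> xf zg; rewrite !affineE => E.
have E0 : \sum_j r j * ((t (f j) * inner x (row j W) + b (f j) -
    (t (g j) * inner z (row j W) + b (g j))) *
    (inner x (row j W) - inner z (row j W))) = 0.
  have : ((y f x - y g z) *m W *m (x - z)^T) ord0 ord0 = 0.
    by rewrite mulmxBl E subrr mul0mx mxE.
  rewrite -mulmxA -[W *m _]trmxK trmx_mul trmxK mxE => E1; rewrite -[RHS]E1.
  apply: eq_bigr => j _; rewrite [_^T _ _]mxE mulmx_trE !mxE.
  rewrite (_ : inner (x - z) _ = inner x (row j W) - inner z (row j W)); first ring.
  by rewrite /inner -sumrB; apply: eq_bigr => i _; rewrite !mxE -mulrBl.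
have ge0 j : 0 <= r j * ((t (f j) * inner x (row j W) + b (f j) -
    (t (g j) * inner z (row j W) + b (g j))) *
    (inner x (row j W) - inner z (row j W))).
  apply: mulr_ge0; first exact: ltW.
  have [->|xz] := eqVneq (inner x (row j W)) (inner z (row j W)).
    by rewrite [X in _ * X]subrr mulr0.
  exact/ltW/(step_transport_mono a_incr t_gt0 glue).
have E1 j : inner x (row j W) = inner z (row j W).
  apply/eqP; apply/negPn/negP => xz.
  move/eqP: E0; rewrite psumr_eq0// => /allP/(_ j); rewrite mem_index_enum => /(_ isT).
  rewrite mulf_eq0 gt_eqF//= gt_eqF//.
  exact: (step_transport_mono a_incr t_gt0 glue).
have E2 : x *m W^T = z *m W^T.
  by apply/rowP => j; rewrite !mulmx_trE E1.
by rewrite -[x](mulmxK uM) -[z](mulmxK uM) /M /gram !mulmxA E2.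
Qed.

(** The Gaussian [h] restricted to the image of [cell f]; injectivity makes these images disjoint,
    hence [sum_F_le]. *)
Let F f x : \bar R := (h x * \1_(cell f) ((x - c f) *m invmx (B f)))%:E.

Let sum_F_le x : (\sum_f F f x <= (h x)%:E)%E.
Proof.
rewrite sumEFin lee_fin -mulr_sumr ler_piMr ?expR_ge0//.
have [[f xf]|xn] := pselect (exists f, cell f ((x - c f) *m invmx (B f))).
  rewrite (bigD1 f)//= big1 ?addr0 => [|g gf].
    by rewrite indicE; case: (_ \in _).
  rewrite indicE memNset// => xg; move/eqP: gf; apply.
  have invK u : (x - c u) *m invmx (B u) *m B u + c u = x.
    by rewrite mulmxKV ?subrK// posdef_unitmx.
  have E := affine_inj xf xg (etrans (invK f) (esym (invK g))).
  apply/ffunP => j; apply/val_inj/esym; move: (xg j); rewrite -E => xgj.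
  exact: (step_cell_inj a_incr (xf j) xgj).
rewrite big1// => f _; rewrite indicE memNset// => xf; apply: xn.
by exists f.
Qed.

Let mF f : vmeas (F f).
Proof.
apply/vmeas_EFinP; apply: measurable_funM.
  by apply/vmeas_EFinP; exact: vmeas_gauss.
have : vmeas (fun x => (\1_(cell f) (x *m invmx (B f) + - (c f *m invmx (B f))))%:E).
  apply: (vmeas_affine (f := fun x => (\1_(cell f) x)%:E)).
  exact: (vmeas_indic (mcell f)).
move=> /vmeas_EFinP m1; rewrite (_ : (fun t => _) =
  (fun t => \1_(cell f) (vec t *m invmx (B f) + - (c f *m invmx (B f)))))//.
by apply/funext => z /=; rewrite mulmxBl.
Qed.

Let cell_le f : (c0%:E * volume (cell f) <= vint (F f))%E.
Proof.
have F0 x : (0 <= F f x)%E by rewrite lee_fin mulr_ge0 ?expR_ge0.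
have dB : 0 < \det (B f) by exact: det_posdef.
have -> : vint (F f) = ((\det (B f))%:E * vint (fun x => F f (x *m B f + c f)))%E.
  rewrite (vint_affine (c f) (pB f) (mF f) F0) muleA -EFinM divff ?mul1e//.
  by rewrite gt_eqF.
have mFB : vmeas (fun x => F f (x *m B f + c f)) by exact: vmeas_affine.
have m1 : vmeas (fun x => (\1_(cell f) x)%:E) by exact: (vmeas_indic (mcell f)).
rewrite volume_vint//.
rewrite -(vintZl m1 _ (ltW c0_gt0)); last by move=> x; rewrite lee_fin.
rewrite -(vintZl mFB _ (ltW dB)); last by move=> x; exact: F0.
apply: le_vint.
- exact: (measurable_funeM _ m1).
- exact: (measurable_funeM _ mFB).
- by move=> x; rewrite -EFinM lee_fin mulr_ge0// ltW.
- move=> x; rewrite /F addrK mulmxK ?posdef_unitmx// -!EFinM lee_fin mulrA indicE.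
  case: (boolP (x \in cell f)) => xf; rewrite ?mulr1 ?mulr0//.
  exact: (jacobian_ge (set_mem xf)).
Qed.

Lemma ball_bound_steps :
  (c0%:E * volume [set x | forall j, strip (row j W) x] <=
   (Num.sqrt (pi ^+ n * \det M))%:E)%E.
Proof.
have <- : vint (fun x => (h x)%:E) = (Num.sqrt (pi ^+ n * \det M))%:E.
  by rewrite (vint_gauss (posdef_inv pM)) det_inv invrK.
have mK : measurable_vset [set x | forall j, strip (row j W) x].
  by apply: measurable_vset_forall => j; exact: measurable_strip.
have m1 f : vmeas (fun x => (\1_(cell f) x)%:E) by exact: (vmeas_indic (mcell f)).
have F0 f x : (0 <= F f x)%E by rewrite lee_fin mulr_ge0 ?expR_ge0.
apply: (@le_trans _ _ (\sum_f (c0%:E * volume (cell f)))%E).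
  rewrite -ge0_sume_distrr => [|f _]; last exact: measure_ge0.
  rewrite lee_wpmul2l ?lee_fin ?(ltW c0_gt0)//.
  rewrite (eq_bigr (fun f => vint (fun x => (\1_(cell f) x)%:E))) => [|f _]; last first.
    by rewrite volume_vint.
  rewrite volume_vint// -vint_sum//.
  apply: le_vint => [||x|x].
  - exact: (vmeas_indic mK).
  - by apply: emeasurable_sum => f; exact: m1.
  - by rewrite lee_fin.
  rewrite sumEFin lee_fin [leLHS]indicE.
  case: (boolP (x \in _)) => xK; last by rewrite sumr_ge0.
  (* The cells are half-open; the strict inequality 1 < a_N lets them cover the endpoint 1 of
     [-1, 1]. *)
  have cE j : exists i : 'I_N, a i <= inner x (row j W) < a i.+1.
    apply: step_cell_exists; have /= := set_mem xK j.
    rewrite /strip/= ler_norml a_first => /andP[-> x1]; exact: le_lt_trans a_last.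
  have [g gP] := choice cE.
  rewrite (bigD1 [ffun j => g j])//= indicE mem_set; last first.
    by move=> j; rewrite ffunE.
  by rewrite lerDl sumr_ge0.
apply: (@le_trans _ _ (\sum_f vint (F f))%E).
  by apply: lee_sum => f _; exact: cell_le.
rewrite -vint_sum//; apply: le_vint => //.
- by apply: emeasurable_sum => f; exact: mF.
- exact: vmeas_gauss.
- by move=> x; apply: sume_ge0 => f _.
Qed.

Let sqrt_expR (x : R) : Num.sqrt (expR x) = expR (x / 2).
Proof.
have -> : expR x = expR (x / 2) ^+ 2 by rewrite expr2 -expRD -splitr.
by rewrite sqrtr_sqr ger0_norm// expR_ge0.
Qed.

(** Since the q_j add up to n, sum_j q_j ln q_j is least when all equal n/s; the tangent of x ln x
    at n/s proves it. *)
Let sum_lnr_ge : (0 < n)%N -> (0 < s)%N ->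
  Num.sqrt ((n%:R / s%:R) ^+ n) <= expR (\sum_j q j * ln (r j)).
Proof.
move=> n0 s0; have ns0 : 0 < n%:R / s%:R :> R by rewrite divr_gt0// ltr0n.
rewrite -[n%:R / s%:R]lnK// -expRM_natl sqrt_expR ler_expR.
rewrite ler_pdivrMr// mulr_suml.
apply: (@le_trans _ _ (\sum_j q j * ln (q j))); last first.
  apply: ler_sum => j _; rewrite /r; case: eqP => [->|_]; first by rewrite !mul0r.
  by rewrite -powR12_sqrt// ln_powR; lra.
apply: (@le_trans _ _ (\sum_j (q j * (1 + ln (n%:R / s%:R)) - n%:R / s%:R))).
  have E : (n%:R / s%:R) *+ s = n%:R :> R.
    by rewrite -[LHS]mulr_natr divfK// pnatr_eq0 -lt0n.
  rewrite sumrB -mulr_suml sum_leverage// sumr_const card_ord E; lra.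
by apply: ler_sum => j _; exact: xlnx_ge.
Qed.

Lemma ball_bound_of_steps : (0 < n)%N ->
  (volume [set x | forall j, strip (row j W) x] <=
    (k ^- n * Num.sqrt (pi ^+ n / \det M * (s%:R / n%:R) ^+ n))%:E)%E.
Proof.
move=> n0; have s0 : (0 < s)%N.
  rewrite lt0n; apply/eqP => s0; have := sum_leverage uM.
  rewrite big1 => [/eqP|[j js]]; last by exfalso; rewrite s0 in js.
  by rewrite eq_sym pnatr_eq0 -[_ == _]negbK -lt0n n0.
have d0 := det_posdef pM; have kn0 : 0 < k ^+ n by rewrite exprn_gt0.
have ns0 : 0 < n%:R / s%:R :> R by rewrite divr_gt0// ltr0n.
have := ball_bound_steps; rewrite muleC -lee_pdivlMr// => /le_trans; apply.
rewrite lee_fin ler_pdivrMr//.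
have E0 := sum_lnr_ge n0 s0.
rewrite [leRHS](_ : _ = (Num.sqrt (pi ^+ n / \det M * (s%:R / n%:R) ^+ n) * \det M) *
  expR (\sum_j q j * ln (r j))); last first.
  by rewrite /c0; field; rewrite gt_eqF.
apply: (@le_trans _ _ ((Num.sqrt (pi ^+ n / \det M * (s%:R / n%:R) ^+ n) * \det M) *
  Num.sqrt ((n%:R / s%:R) ^+ n))); last first.
  by rewrite ler_wpM2l// mulr_ge0 ?sqrtr_ge0// ltW.
have dE : \det M = Num.sqrt (\det M ^+ 2) by rewrite sqrtr_sqr ger0_norm// ltW.
have p0 : 0 <= pi ^+ n :> R by rewrite exprn_ge0 ?pi_ge0.
have sn0 : 0 <= (s%:R / n%:R) ^+ n :> R by rewrite exprn_ge0// divr_ge0.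
rewrite [X in _ * X * _]dE -!sqrtrM ?mulr_ge0 ?sqr_ge0 ?invr_ge0 ?(ltW d0)//.
rewrite le_eqVlt; apply/orP; left; apply/eqP; congr (Num.sqrt _).
rewrite -[(s%:R / n%:R)]invf_div exprVn; field.
by rewrite !gt_eqF// exprn_gt0// ltr0n.
Qed.

End ball_bound.

(** As [k] tends to sqrt(pi) / 2 the bound tends to Ball's 2^n (s/n)^(n/2) det M^(-1/2); a smaller
    [k] keeps the number of affine pieces finite. *)
Lemma ball_bound s n (W : 'M[R]_(s, n)) (M := gram W (fun=> 1)) k :
  M \in unitmx -> (0 < n)%N -> 0 < k -> k < Num.sqrt pi / 2 ->
  (volume [set x | forall j, strip (row j W) x] <=
    (k ^- n * Num.sqrt (pi ^+ n / \det M * (s%:R / n%:R) ^+ n))%:E)%E.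
Proof.
move=> uM n0 k0 kpi.
have [N [a [t [b [a_first a_last a_incr tb]]]]] := gauss_steps k0 kpi.
apply: (ball_bound_of_steps (t := t) (b := b) uM k0 a_first a_last a_incr) => //.
- by move=> i; have [] := tb i.
- by move=> i; have [] := tb i.
- by move=> i; have [] := tb i.
Qed.

End ball.

(** * Arbitrary families of strips: measurability and degeneracy *)

Section strips_family.
Context {R : realType}.
Local Notation RT := (measurableTypeR R).

Lemma inner_continuous_at n (x w : 'rV[R]_n) : 1 < `|inner x w| ->
  exists2 e : R, 0 < e &
    forall y : 'rV[R]_n, (forall j, `|y ord0 j - x ord0 j| < e) -> 1 < `|inner y w|.
Proof.
move=> xw; pose S := \sum_j `|w ord0 j|.
have S0 : 0 <= S by apply: sumr_ge0.
have S1 : 0 < 1 + S by rewrite (lt_le_trans ltr01)// lerDl.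
exists ((`|inner x w| - 1) / (1 + S)); first by rewrite divr_gt0// subr_gt0.
move=> y; set e := _ / _ => ye.
have e0 : 0 < e by rewrite divr_gt0// subr_gt0.
have yx : `|inner x w - inner y w| <= e * S.
  rewrite /inner -sumrB mulr_sumr (le_trans (ler_norm_sum _ _ _))//.
  apply: ler_sum => j _; rewrite -mulrBl normrM distrC.
  by rewrite ler_wpM2r// ltW.
have eS : e * S < `|inner x w| - 1.
  by rewrite -[ltRHS](divfK (lt0r_neq0 S1)) -/e ltr_pM2l// ltrDr.
have := lerB_dist (inner x w) (inner y w); lra.
Qed.

(* I may be uncountable: the complement is a countable union of rational boxes. *)
Lemma measurable_bigcap_strip n (I : Type) (w : I -> 'rV[R]_n) :
  measurable_vset (\bigcap_(i in [set: I]) strip (w i)).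
Proof.
set P := \bigcap_(i in _) _.
pose box (z : {ffun 'I_n -> rat} * rat) : set 'rV[R]_n :=
  [set x | forall j, `|x ord0 j - ratr (z.1 j)| < ratr z.2].
pose G z := if `[< box z `&` P = set0 >] then box z else set0.
rewrite /measurable_vset.
have -> : [set t : n.-tuple RT | P (vec t)] = ~` \bigcup_z [set t | G z (vec t)].
  apply/seteqP; split => t /=.
    move=> Pt [z _]; rewrite /G /=; case: asboolP => // zP zt.
    by have : (box z `&` P) (vec t) by []; rewrite zP.
  apply: contra_notP => nP; have [i iP] : exists i, ~ strip (w i) (vec t).
    by apply/existsNP => h; apply: nP => i _; exact: h.
  have {iP} ti : 1 < `|inner (vec t) (w i)| by rewrite ltNge; apply/negP.
  have [e e0 eP] := inner_continuous_at ti.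
  (* Half of [e], because two points of one box may differ by almost 2 e' in a coordinate. *)
  have [e' /[!in_itv]/= /andP[e'0 e'e]] := rat_in_itvoo (divr_gt0 e0 (ltr0n R 2)).
  have qex j : exists q : rat, `|vec t ord0 j - ratr q| < ratr e'.
    have [q /[!in_itv]/= /andP[q1 q2]] :=
      @rat_in_itvoo R (vec t ord0 j) (vec t ord0 j + ratr e') (ltac:(by rewrite ltrDl)).
    by exists q; rewrite distrC gtr0_norm ?subr_gt0// ltrBlDl.
  have [q qP] := choice qex.
  have tb : box ([ffun j => q j], e') (vec t) by move=> j; rewrite ffunE.
  exists ([ffun j => q j], e') => //; rewrite /G/=; case: asboolP => // h; exfalso; apply: h.
  apply/seteqP; split => // y [/= yb yP].
  have : 1 < `|inner y (w i)|.
    apply: eP => j; have := yb j; have := tb j; rewrite /= ffunE => h1 h2.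
    have := ler_distD (ratr (q j)) (y ord0 j) (vec t ord0 j).
    rewrite (distrC (ratr (q j))); lra.
  by have := yP i Logic.I; rewrite /strip/= leNgt => /negP.
apply: measurableC; apply: countable_bigcupT_measurable; first exact: countableP.
move=> z; rewrite /G; case: asboolP => _; last first.
  by rewrite (_ : [set _ | _] = set0).
apply: (@measurable_vset_forall _ _ _ (fun j =>
  [set x : 'rV[R]_n | `|x ord0 j - ratr (z.1 j)| < ratr z.2])) => j.
rewrite /measurable_vset -[X in measurable X]setTI.
rewrite (_ : [set _ | _] = (fun t => vec t ord0 j) @^-1`
  `](ratr (z.1 j) - ratr z.2), (ratr (z.1 j) + ratr z.2)[%classic).
  exact: measurable_vec.
by apply/seteqP; split => t /=; rewrite in_itv/= ltr_distl.
Qed.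

Lemma qformD1 n (M : 'M[R]_n) (u x : 'rV[R]_n) :
  qform (M + u^T *m u) x = qform M x + inner x u ^+ 2.
Proof.
rewrite /qform mulmxDr mulmxDl mxE; congr (_ + _).
have E : u *m x^T = (x *m u^T)^T by rewrite trmx_mul trmxK.
by rewrite mulmxA -mulmxA E mxE big_ord1 [(_^T) _ _]mxE -inner_mulmx expr2.
Qed.

Lemma posdef_rank_one n (M : 'M[R]_n) (u : 'rV[R]_n) :
  posdef M -> posdef (M + u^T *m u).
Proof.
move=> [sM M0]; split; first by rewrite linearD/= trmx_mul trmxK sM.
move=> x x0; rewrite qformD1; apply: ltr_wpDr; [exact: sqr_ge0|exact: M0].
Qed.

(* The intersection is invariant under 1 + v^T v, whose determinant exceeds 1. *)
Lemma volume_degenerate n (I : Type) (w : I -> 'rV[R]_n) (v : 'rV[R]_n) :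
  v != 0 -> (forall i, inner v (w i) = 0) ->
  (0 < volume (\bigcap_(i in [set: I]) strip (w i)))%E ->
  volume (\bigcap_(i in [set: I]) strip (w i)) = +oo%E.
Proof.
move=> v0 vw; set P := \bigcap_(i in _) _ => P0.
have p1 : posdef (1%:M : 'M[R]_n) by apply: posdef_scalar.
have pB := posdef_rank_one v p1.
have dB : 1 < \det (1%:M + v^T *m v).
  rewrite -[v^T *m v]scale1r det_rank_one_update ?unitmx1// det1 !mul1r ltrDl.
  exact: (posdef_inv p1).2.
have mP : measurable_vset P by exact: measurable_bigcap_strip.
have : volume P = ((\det (1%:M + v^T *m v))^-1%:E * volume P)%E.
  rewrite volume_vint//.
  rewrite -(vint_affine 0 (f := fun x => (\1_P x)%:E) pB); last 2 first.
  - exact: (vmeas_indic mP).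
  - by move=> x; rewrite lee_fin.
  apply: eq_vint => x; rewrite !indicE; congr ((nat_of_bool _)%:R%:E).
  have E i : inner (x *m (1%:M + v^T *m v) + 0) (w i) = inner x (w i).
    have vwi : v *m (w i)^T = 0.
      by apply/matrixP => a b; rewrite !ord1 -inner_mulmx vw mxE.
    by rewrite addr0 !inner_mulmx mulmxDr mulmx1 mulmxDl -!mulmxA vwi !mulmx0 addr0.
  by apply/idP/idP => /set_mem h; apply/mem_set => i _; have := h i Logic.I;
    rewrite /strip/= E.
move: P0; case: (volume P) => [r| |//]//.
rewrite lte_fin => r0 [E]; exfalso; move: E => /eqP.
rewrite -subr_eq0 -{1}[r]mul1r -mulrBl mulf_eq0 (gt_eqF r0) orbF subr_eq0 => /eqP E.
by move: dB; rewrite -[\det _]invrK -E invr1 ltxx.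
Qed.

End strips_family.

(** * Spanning tuples and the exchange argument *)

Section selection.
Context {R : realType}.

Lemma gram_unitmx s n (W : 'M[R]_(s, n)) :
  row_full W -> gram W (fun=> 1) \in unitmx.
Proof.
move=> /row_fullP[C CW]; rewrite -row_free_unit; apply: inj_row_free => v vG.
have : qform (gram W (fun=> 1)) v = 0 by rewrite /qform vG mul0mx mxE.
rewrite qform_gram => /eqP; rewrite psumr_eq0 => [/allP h|j _]; last first.
  by rewrite mul1r sqr_ge0.
have E : v *m W^T = 0.
  apply/rowP => j; have := h j; rewrite mem_index_enum mul1r sqrf_eq0 mulmx_trE.
  by move=> /(_ isT)/eqP ->; rewrite mxE.
by rewrite -[v]mulmx1 -trmx1 -CW trmx_mul mulmxA E mul0mx.
Qed.

(** Greedy choice: while the rank is below n, add a normal that is not orthogonal to some vector of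
    the orthogonal complement; afterwards pad with [i0]. *)
Lemma spanning_tuple n (I : Type) (w : I -> 'rV[R]_n) (s : nat) (i0 : I) :
  (forall v, v != 0 -> exists i, inner v (w i) != 0) -> (n <= s)%N ->
  exists S : 'I_s -> I, gram (\matrix_j w (S j)) (fun=> 1) \in unitmx.
Proof.
move=> span ns.
have [L [Ls Lr]] : exists L : seq I, size L = s /\
    (minn s n <= \rank (\sum_(i <- L) <<w i>>)%MS)%N.
  elim: s {ns} => [|s [L [Ls Lr]]]; first by exists [::]; rewrite min0n.
  have [rn|rn] := ltnP (\rank (\sum_(i <- L) <<w i>>)%MS) n; last first.
    exists (i0 :: L); rewrite /= Ls; split=> //.
    rewrite big_cons (leq_trans (geq_minr _ _))// (leq_trans rn)//.
    exact/mxrankS/addsmxSr.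
  set A := (\sum_(i <- L) <<w i>>)%MS in Lr rn.
  have [v v0 vA] : exists2 v : 'rV[R]_n, v != 0 & v *m A^T = 0.
    exists (nz_row (kermx A^T)).
      rewrite nz_row_eq0 -mxrank_eq0 mxrank_ker mxrank_tr.
      by rewrite subn_eq0 -ltnNge.
    by apply/eqP; rewrite -sub_kermx nz_row_sub.
  have [i iv] := span v v0.
  exists (i :: L); rewrite /= Ls; split=> //; rewrite big_cons -/A.
  have : (A < <<w i>> + A)%MS.
    rewrite ltmxE addsmxSr/=; apply: contra iv => iA.
    have /submxP[D wD] : (w i <= A)%MS.
      by rewrite (submx_trans _ iA)// (submx_trans _ (addsmxSl _ _))// genmxE.
    by rewrite inner_mulmx wD trmx_mul mulmxA vA mul0mx mxE.
  rewrite ltmxErank => /andP[_ rA].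
  have [sn|sn] := leqP n s.
    by move: Lr; rewrite (minn_idPr sn) leqNgt rn.
  by rewrite (minn_idPl sn) (leq_ltn_trans _ rA)// -[leqLHS](minn_idPl (ltnW sn)).
exists (fun j => nth i0 L j); apply: gram_unitmx.
rewrite -sub1mx; have full : row_full (\sum_(i <- L) <<w i>>)%MS.
  by rewrite /row_full eqn_leq rank_leq_col -[leqLHS](minn_idPr ns).
rewrite -sub1mx in full; apply: submx_trans full _.
rewrite big_tnth; apply/sumsmx_subP => k _; rewrite genmxE.
have ks : (k < s)%N by rewrite -Ls.
rewrite (_ : w _ = row (Ordinal ks) (\matrix_j w (nth i0 L j))) ?row_sub//.
by rewrite rowK (tnth_nth i0).
Qed.

Lemma gramE s n (W : 'M[R]_(s, n)) :
  gram W (fun=> 1) = \sum_j (row j W)^T *m row j W.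
Proof.
apply/matrixP => i k; rewrite /gram mxE summxE; apply: eq_bigr => j _.
by rewrite mul_mx_diag !mxE mulr1 big_ord1 !mxE.
Qed.

Lemma gram_replace s n (u : 'I_s -> 'rV[R]_n) j (v : 'rV[R]_n) :
  gram (\matrix_k (if k == j then v else u k)) (fun=> 1) =
  gram (\matrix_k u k) (fun=> 1) + v^T *m v + (-1) *: ((u j)^T *m u j).
Proof.
rewrite !gramE (bigD1 j)//= [in RHS](bigD1 j)//= !rowK eqxx scaleN1r.
rewrite (eq_bigr (fun k => (row k (\matrix_k u k))^T *m row k (\matrix_k u k))).
  by rewrite addrAC [X in _ = X + _]addrAC subrr add0r addrC.
by move=> k /negPf kj; rewrite !rowK kj.
Qed.

(* Exchanging one vector of an almost optimal tuple for w, averaged over the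
   exchanged vector, bounds w in the norm dual to the Gram matrix. *)
Lemma exchange_bound s n (u : 'I_s -> 'rV[R]_n) (v : 'rV[R]_n) (mu : R)
    (M := gram (\matrix_k u k) (fun=> 1)) :
  (0 < n)%N -> (n <= s)%N -> 1 <= mu -> posdef M ->
  (forall j, \det (gram (\matrix_k (if k == j then v else u k)) (fun=> 1)) <=
     (1 + (mu - 1) * n%:R / s%:R) * \det M) ->
  forall x, qform M x <= (s%:R - n%:R + 1) / (mu * n%:R) -> `|inner x v| <= 1.
Proof.
move=> n0 ns mu1 pM hj x xM.
(* Every exchange is a rank one removal from the same matrix [N], so all the determinants are
   expressed through [invmx N]. *)
pose N := M + v^T *m v; have pN : posdef N by exact: posdef_rank_one.
have uN := posdef_unitmx pN; have dN := det_posdef pN; have dM := det_posdef pM.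
pose z := qform (invmx N) v.
have ME : M = N + (-1) *: (v^T *m v) by rewrite scaleN1r addrK.
have dMz : \det M = \det N * (1 - z).
  by rewrite {1}ME det_rank_one_update// mulN1r.
have y0 : 0 < 1 - z by rewrite -(pmulr_rgt0 _ dN) -dMz.
have s0 : 0 < s%:R :> R by rewrite ltr0n (leq_trans n0).
have nR0 : 0 < n%:R :> R by rewrite ltr0n.
have nsR : n%:R <= s%:R :> R by rewrite ler_nat.
have sumz : \sum_j qform (invmx N) (u j) = n%:R - z.
  transitivity (\sum_j qform (invmx N) (row j (\matrix_k u k))).
    by apply: eq_bigr => j _; rewrite rowK.
  rewrite sum_qform_row -/M ME mulmxDr mulVmx// linearD/= mxtrace1.
  rewrite -scalemxAr linearZ/= mulN1r; congr (_ - _).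
  by rewrite mulmxA mxtrace_mulC /z /qform mulmxA trace_mx11.
(* The sum over [j] of the exchange hypotheses, divided by det N. *)
have key : s%:R - n%:R + z <= (s%:R + (mu - 1) * n%:R) * (1 - z).
  have : \sum_(j < s) (\det N * (1 - qform (invmx N) (u j))) <=
      \sum_(j < s) (1 + (mu - 1) * n%:R / s%:R) * \det M.
    apply: ler_sum => j _; apply: le_trans (hj j).
    by rewrite gram_replace -/M -/N det_rank_one_update// mulN1r.
  rewrite -mulr_sumr sumrB sumz !sumr_const card_ord dMz.
  rewrite -[X in _ <= X]mulr_natr.
  rewrite (_ : _ * s%:R = \det N * ((s%:R + (mu - 1) * n%:R) * (1 - z))); last first.
    by field; rewrite gt_eqF.
  by rewrite ler_pM2l// => h; lra.
(* Cauchy-Schwarz in the norm of [N], which itself contains <x, v>^2; solving for that square brings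
   back the norm of [M]. *)
have h1 : inner x v ^+ 2 <= qform N x * z by exact: inner_sqr_le.
rewrite qformD1 in h1.
have h2 : inner x v ^+ 2 * (1 - z) <= qform M x * z by lra.
have z0 : 0 <= z by exact/posdef_qform_ge0/posdef_inv.
have m0 : 0 < mu * n%:R by rewrite mulr_gt0// (lt_le_trans ltr01).
(* After subtraction of (s - n)(1 - z), [key] reads (s - n + 1) z <= mu n (1 - z). *)
have h3 : (s%:R - n%:R + 1) / (mu * n%:R) * z <= 1 - z.
  rewrite mulrAC ler_pdivrMr//; lra.
have h4 : qform M x * z <= (s%:R - n%:R + 1) / (mu * n%:R) * z by rewrite ler_wpM2r.
have : inner x v ^+ 2 <= 1.
  by rewrite -(ler_pM2r y0) mul1r (le_trans h2)// (le_trans h4).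
by rewrite -[leLHS]real_normK ?num_real// expr_le1.
Qed.

End selection.

(** With r = sqrt d, one has s <= r^2 n and s - n + 1 > (r^2 - 1) n, so it is enough that (r + 1)^3
    > r^2 (r - 1). *)
Lemma gamma_ratio_gt (R : realType) (d : R) (n s : nat) : (0 < n)%N -> 1 < d ->
  s%:R <= d * n%:R < s.+1%:R ->
  s%:R < gamma_ratio d * (s%:R - n%:R + 1).
Proof.
move=> n0 d1 /andP[sd ds]; rewrite /gamma_ratio; set r := Num.sqrt d.
have nR0 : 0 < n%:R :> R by rewrite ltr0n.
have dE : d = r ^+ 2 by rewrite sqr_sqrtr// ltW// (lt_trans ltr01).
have r1 : 1 < r by rewrite -sqrtr1 ltr_sqrt// (lt_trans ltr01).
have r10 : 0 < r - 1 by rewrite subr_gt0.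
apply: (@le_lt_trans _ _ (r ^+ 2 * n%:R)); first by rewrite -dE.
apply: (@lt_trans _ _ (((r + 1) / (r - 1)) ^+ 2 * ((r ^+ 2 - 1) * n%:R))).
  have -> : ((r + 1) / (r - 1)) ^+ 2 * ((r ^+ 2 - 1) * n%:R) =
      (r + 1) ^+ 3 / (r - 1) * n%:R by field; rewrite gt_eqF.
  rewrite ltr_pM2r// ltr_pdivlMr//; nra.
rewrite ltr_pM2l ?exprn_gt0 ?divr_gt0//; last by rewrite addr_gt0// (lt_trans ltr01).
by rewrite mulrBl mul1r -dE; move: ds; rewrite -natr1; lra.
Qed.

(** * Volume bound for an almost optimal subfamily *)

Section main.
Variables (R : realType) (n : nat) (I : Type) (w : I -> 'rV[R]_n).

Let P := \bigcap_(i in [set: I]) strip (w i).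
Let K s (S : 'I_s -> I) := \bigcap_(k in [set: 'I_s]) strip (w (S k)).
Let f s (S : 'I_s -> I) := \det (gram (\matrix_j w (S j)) (fun=> 1)).

Lemma subtuple_volume_le s (S : 'I_s -> I) (k : R) :
  (0 < n)%N -> f S != 0 -> 0 < k -> k < Num.sqrt pi / 2 ->
  (volume (K S) <= (k ^- n * Num.sqrt (pi ^+ n / f S * (s%:R / n%:R) ^+ n))%:E)%E.
Proof.
move=> n0 fS k0 kpi.
have uM : gram (\matrix_j w (S j)) (fun=> 1) \in unitmx by rewrite unitmxE unitfE.
rewrite (_ : K S = [set x | forall j, strip (row j (\matrix_j w (S j))) x]).
  exact: ball_bound.
apply/seteqP; split => x /= h j; first by rewrite rowK; exact: h.
by move=> _; have := h j; rewrite rowK.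
Qed.

(** Every subfamily contains P in its intersection, while Ball's bound tends to 0 as the determinant
    grows; so a positive |P| limits the determinant. *)
Lemma det_family_bounded s : (0 < n)%N -> (0 < volume P)%E -> volume P \is a fin_num ->
  exists C, forall S : 'I_s -> I, f S <= C.
Proof.
move=> n0 P0 Pfin; pose k : R := Num.sqrt pi / 4.
have pi0 : 0 < Num.sqrt pi :> R by rewrite sqrtr_gt0 pi_gt0.
have k0 : 0 < k by rewrite divr_gt0.
have kpi : k < Num.sqrt pi / 2 by rewrite /k; lra.
have [p PE] : exists p, volume P = p%:E by exists (fine (volume P)); rewrite fineK.
rewrite PE lte_fin in P0.
have C0 : 0 <= (k ^- n / p) ^+ 2 * (pi ^+ n * (s%:R / n%:R) ^+ n).
  by rewrite mulr_ge0 ?sqr_ge0// mulr_ge0 ?exprn_ge0 ?divr_ge0 ?pi_ge0.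
exists ((k ^- n / p) ^+ 2 * (pi ^+ n * (s%:R / n%:R) ^+ n)) => S.
have [fS|fS] := leP (f S) 0; first exact: le_trans C0.
have : (volume P <= volume (K S))%E.
  apply: le_volume; [exact: measurable_bigcap_strip|exact: measurable_bigcap_strip|].
  by move=> x Px j _; exact: Px.
rewrite PE => /le_trans /(_ (subtuple_volume_le n0 (lt0r_neq0 fS) k0 kpi)).
have kn0 : 0 < k ^- n by rewrite invr_gt0 exprn_gt0.
rewrite lee_fin mulrC -ler_pdivrMr// => h.
have : (p / k ^- n) ^+ 2 <= pi ^+ n / f S * (s%:R / n%:R) ^+ n.
  rewrite -[leRHS]sqr_sqrtr; last first.
    by rewrite !mulr_ge0 ?invr_ge0 ?(ltW fS)// exprn_ge0 ?divr_ge0 ?pi_ge0.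
  by rewrite ler_sqr ?nnegrE ?sqrtr_ge0// divr_ge0 ?ltW.
rewrite mulrAC ler_pdivlMr// mulrC -ler_pdivlMr; last first.
  by rewrite exprn_gt0// divr_gt0.
by move=> /le_trans; apply; rewrite mulrC -exprVn invf_div.
Qed.

(** In an infinite family the supremum need not be attained. Finite volume forces the normals to
    span, so the supremum is positive and can be approached within a factor [c]. *)
Lemma near_optimal_tuple s (c : R) : (0 < n)%N -> (n <= s)%N -> 1 < c ->
  (0 < volume P)%E -> volume P \is a fin_num ->
  exists S : 'I_s -> I, 0 < f S /\ forall S' : 'I_s -> I, f S' <= c * f S.
Proof.
move=> n0 ns c1 P0 Pfin.
have c0 : 0 < c by exact: lt_trans c1.
have span v : v != 0 -> exists i, inner v (w i) != 0.
  move=> v0; apply: contrapT => /forallNP h; move: Pfin; rewrite (volume_degenerate v0)// => i.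
  by apply/eqP/negPn/negP; exact: h.
have [i0 _] : exists i, inner (const_mx 1 : 'rV[R]_n) (w i) != 0.
  apply: span; apply/eqP => /rowP/(_ (Ordinal n0)); rewrite !mxE => /eqP.
  by rewrite oner_eq0.
have [S0 uS0] := spanning_tuple i0 span ns.
have fS0 : 0 < f S0 by exact/det_posdef/posdef_gram.
pose E := [set x | exists S : 'I_s -> I, x = f S].
have [C fC] := det_family_bounded s n0 P0 Pfin.
have supE : has_sup E.
  by split; [exists (f S0), S0|exists C => _ [S ->]; exact: fC].
have D0 : 0 < sup E.
  by apply: lt_le_trans fS0 _; apply: sup_upper_bound => //; exists S0.
(* With this margin the chosen tuple satisfies f S > sup E / c. *)
have e0 : 0 < sup E - sup E / c by rewrite subr_gt0 ltr_pdivrMr// ltr_pMr.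
have [_ [S ->]] := sup_adherent e0 supE.
rewrite opprB addrCA subrr addr0 ltr_pdivrMr// mulrC => h.
exists S; split; first by rewrite -(pmulr_rgt0 _ c0) (lt_trans D0).
by move=> S'; apply: (le_trans _ (ltW h)); apply: sup_upper_bound => //; exists S'.
Qed.

(** The slack [mu] enters twice: once for a tuple that is only almost optimal, once for the
    transport constant [k] below its limit. *)
Lemma volume_selection s (mu : R) : (0 < n)%N -> (n <= s)%N -> 1 < mu ->
  (0 < volume P)%E -> volume P \is a fin_num ->
  exists S : 'I_s -> I,
    (volume (K S) <=
     ((4 * (mu ^+ 2 * (s%:R / (s%:R - n%:R + 1))) / pi) `^ (n%:R / 2) *
       Gamma (n%:R / 2 + 1))%:E * volume P)%E.
Proof.
move=> n0 ns mu1 P0 Pfin.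
have nR0 : 0 < n%:R :> R by rewrite ltr0n.
have s0 : 0 < s%:R :> R by rewrite ltr0n (leq_trans n0).
have nsR : n%:R <= s%:R :> R by rewrite ler_nat.
have mu0 : 0 < mu by exact: lt_trans mu1.
have sn0 : 0 < s%:R - n%:R + 1 :> R by lra.
(* The near-optimality factor under which [exchange_bound] loses exactly [mu]. *)
pose c := 1 + (mu - 1) * n%:R / s%:R.
have c1 : 1 < c by rewrite /c ltrDl divr_gt0// mulr_gt0// subr_gt0.
have [S [fS Sopt]] := near_optimal_tuple n0 ns c1 P0 Pfin.
exists S; pose M := gram (\matrix_j w (S j)) (fun=> 1).
have pM : posdef M by apply: posdef_gram => //; rewrite unitmxE unitfE lt0r_neq0.
pose rho := (s%:R - n%:R + 1) / (mu * n%:R).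
have rho0 : 0 < rho by rewrite divr_gt0 ?mulr_gt0//; lra.
have EP : ellipsoid M rho `<=` P.
  move=> x xE i _; apply: (exchange_bound n0 ns (ltW mu1) pM _ xE) => j.
  have := Sopt (fun k => if k == j then i else S k); rewrite -/M /f.
  congr (\det (gram _ _) <= _); apply/matrixP => a b; rewrite !mxE.
  by case: ifP.
have [G0 volE] := volume_ellipsoid pM.
have := le_volume (measurable_ellipsoid M rho) (measurable_bigcap_strip w) EP.
rewrite volume_ellipsoid_scale// volE -EFinM => PE.
(* Chosen so that k^(-n) is the limiting value (4 / pi)^(n/2) times mu^(n/2). *)
pose k : R := Num.sqrt (pi / (4 * mu)).
have pi0 : 0 < pi :> R by exact: pi_gt0.
have k0 : 0 < k by rewrite sqrtr_gt0 divr_gt0// mulr_gt0.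
have kpi : k < Num.sqrt pi / 2.
  have -> : Num.sqrt pi / 2 = Num.sqrt (pi / 4) :> R.
    have -> : pi / 4 = pi * (2^-1) ^+ 2 :> R by field.
    by rewrite sqrtrM ?(ltW pi0)// sqrtr_sqr ger0_norm.
  by rewrite ltr_sqrt ?divr_gt0// ltr_pM2l// ltf_pV2 ?posrE ?mulr_gt0// ltr_pMr.
apply: le_trans (subtuple_volume_le n0 (lt0r_neq0 fS) k0 kpi) _.
set A := (_ `^ _)%R.
have A0 : 0 < A by rewrite powR_gt0// divr_gt0// mulr_gt0// mulr_gt0 ?exprn_gt0// divr_gt0.
apply: le_trans (lee_wpmul2l _ PE); last by rewrite lee_fin mulr_ge0 ?(ltW A0) ?(ltW G0).
rewrite -EFinM lee_fin.
have sqrt_pow (x : R) : 0 <= x -> Num.sqrt (x ^+ n) = x `^ (n%:R / 2).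
  by move=> x0; rewrite -powR12_sqrt ?exprn_ge0// -powR_mulrn// -powRrM.
rewrite [leRHS](_ : _ = A * rho `^ (n%:R / 2) * Num.sqrt (pi ^+ n / \det M)); last first.
  by field; rewrite gt_eqF.
have fE : f S = \det M by [].
have q0 : 0 <= pi ^+ n / \det M by rewrite divr_ge0 ?exprn_ge0 ?ltW// det_posdef.
rewrite fE (sqrtrM _ q0) sqrt_pow ?divr_ge0//.
rewrite [leLHS]mulrCA [leLHS]mulrC ler_pM2r; last first.
  by rewrite sqrtr_gt0 divr_gt0 ?exprn_gt0// det_posdef.
have -> : k ^- n = (4 * mu / pi) `^ (n%:R / 2).
  have m0 : 0 <= 4 * mu / pi by rewrite divr_ge0 ?mulr_ge0// ltW.
  rewrite -exprVn /k -sqrtrV; last by rewrite divr_ge0 ?mulr_ge0// ltW.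
  by rewrite invf_div -powR12_sqrt// -powR_mulrn ?powR_ge0// -powRrM [2^-1 * _]mulrC.
have m0 : 0 <= 4 * mu / pi by rewrite divr_ge0 ?mulr_ge0// ltW.
have sn1 : 0 <= s%:R / n%:R :> R by rewrite divr_ge0.
rewrite -powRM// /A -powRM ?(ltW rho0)//; last first.
  by rewrite divr_ge0 ?(ltW pi0)// mulr_ge0// mulr_ge0 ?sqr_ge0// divr_ge0// ltW.
rewrite le_eqVlt; apply/orP; left; apply/eqP; congr (_ `^ _).
rewrite /rho; move: (pi : R) pi0 => p p0.
by field; rewrite !gt_eqF.
Qed.

End main.

(** * Choice of s and of the slack *)

Theorem theorem1p2 (R : realType) (n : nat) (I : Type) (w : I -> 'rV[R]_n)
    (hP : (0 < volume (\bigcap_(i in [set: I]) strip (w i)))%E)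
    (d : R) (hd : 1 < d) :
  exists (s : nat) (i : 'I_s -> I),
    s%:R <= d * n%:R /\
    (volume (\bigcap_(k in [set: 'I_s]) strip (w (i k))) <=
     ((4 * gamma_ratio d / pi) `^ (n%:R / 2) * Gamma (n%:R / 2 + 1))%:E
       * volume (\bigcap_(j in [set: I]) strip (w j)))%E.
Proof.
have r1 : 1 < Num.sqrt d by rewrite -sqrtr1 ltr_sqrt// (lt_trans ltr01).
have gamma0 : 0 < gamma_ratio d.
  by rewrite exprn_gt0// divr_gt0 ?subr_gt0// addr_gt0// (lt_trans ltr01).
have [G0 vol1] := volume_ellipsoid (posdef_scalar n (@ltr01 R)).
have A0 : 0 < (4 * gamma_ratio d / pi) `^ (n%:R / 2).
  by rewrite powR_gt0// divr_gt0 ?pi_gt0// mulr_gt0.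
have [Poo|Pfin] : volume (\bigcap_(i in [set: I]) strip (w i)) = +oo%E \/
    volume (\bigcap_(i in [set: I]) strip (w i)) \is a fin_num.
  by case: (volume _) hP => [r| |]; [right|left|].
(* The right-hand side is infinite, its real factor being positive, so the empty subfamily will
   do. *)
- exists 0, (fun k : 'I_0 => False_rect I (notF (ltn_ord k))).
  split; first by rewrite mulr_ge0// ltW// (lt_trans ltr01).
  by rewrite Poo mulry gtr0_sg ?mulr_gt0// mul1e leey.
have [n0|n0] := posnP n.
  subst n; exists 0, (fun k : 'I_0 => False_rect I (notF (ltn_ord k))).
  split; first by rewrite mulr0.
  have allT (A : set 'rV[R]_0) : A 0 -> A = setT.
    by move=> A00; apply/seteqP; split => // x _; rewrite (_ : x = 0)//; apply/rowP => -[].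
  have strip0 v : strip v (0 : 'rV[R]_0) by rewrite /strip/= /inner big_ord0 normr0.
  have capT (J : Type) (u : J -> 'rV[R]_0) :
      volume (\bigcap_(i in [set: J]) strip (u i)) = 1%E.
    rewrite (allT (\bigcap_(i in _) _)); last by move=> i _; exact: strip0.
    have := @volume_box R 0 (fun=> setT) (fun=> measurableT); rewrite big_ord0 => <-.
    by congr volume; apply/seteqP; split => // x _ [].
  (* In dimension 0 all volumes are 1; the ellipsoid formula then yields Gamma(1) = 1. *)
  have V1 : volume (ellipsoid (1%:M : 'M[R]_0) 1) = 1%E.
    rewrite -(capT 'I_0 (fun=> 0)) (allT (ellipsoid _ _)); last first.
      by rewrite /ellipsoid/= /qform !mul0mx mxE.
    by rewrite (allT (\bigcap_(i in _) _))// => i _; exact: strip0.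
  move: vol1; rewrite !capT V1 mul0r powRr0 mul1r mule1 lee_fin => -[] /esym/eqP.
  rewrite expr0 det_mx00 divr1 sqrtr1 mul1r invr_eq1 => /eqP G1.
  by move: G1; rewrite ?mul0r => ->.
pose s := Num.truncn (d * n%:R).
have /andP[sd ds] : s%:R <= d * n%:R < s.+1%:R.
  by apply: truncn_itv; rewrite mulr_ge0// ltW// (lt_trans ltr01).
have ns : (n <= s)%N.
  by rewrite -ltnS -(ltr_nat R) (le_lt_trans _ ds)// ler_peMl// ltW.
have sg := gamma_ratio_gt n0 hd (introT andP (conj sd ds)).
have sR0 : 0 < s%:R :> R by rewrite ltr0n; exact: leq_trans ns.
(* The room left by the strict inequality; the slack mu = sqrt g turns mu^2 s / (s - n + 1) into
   gamma_d exactly. *)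
pose g := gamma_ratio d * (s%:R - n%:R + 1) / s%:R.
have g1 : 1 < g by rewrite /g ltr_pdivlMr// mul1r.
have mu1 : 1 < Num.sqrt g by rewrite -sqrtr1 ltr_sqrt// (lt_trans ltr01).
have [S hS] := volume_selection n0 ns mu1 hP Pfin.
exists s, S; split=> //; apply: le_trans hS _.
rewrite (_ : _ * (s%:R / _) = gamma_ratio d)//.
have nsR : n%:R <= s%:R :> R by rewrite ler_nat.
rewrite sqr_sqrtr; last exact: ltW (lt_trans ltr01 g1).
rewrite /g; field; apply/andP; split; apply: lt0r_neq0 => //.
by rewrite ltr_wpDl// subr_ge0.
Qed.
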